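(* Let $X$ be a real Hilbert space and $N\ge2$. Let $G=(\mathcal{N},\mathcal{E})$ be a connected directed graph with $\mathcal{N}=\{1,\dots,N\}$ such that $(i,j)\in\mathcal{E}$ implies $i<j$, and let $G'=(\mathcal{N},\mathcal{E}')$ be a connected subgraph of $G$, with associated matrix $S$, operator $\mathcal{S}$, and degrees $d_i,d_i^+$ as in the context. Let $A_1,\dots,A_N$ be maximally monotone operators on $X$ such that $\operatorname{zer}\bigl(\sum_{i=1}^NA_i\bigr)\neq\varnothing$, let $\Gamma\subseteq\mathbb{R}_{++}$ be nonempty, and let $\theta\in\left]0,2\right[$. Let $(\gamma_n)_{n\in\mathbb{N}}$ be a sequence in $\Gamma$ that converges to some $\overline{\gamma}\in\Gamma$ and satisfies $$\sum_{n\in\mathbb{N}}(\mathcal{L}_{\gamma_{n+1}\gets\gamma_n}-1)<+\infty,$$ where, for $\gamma,\delta\in\mathbb{R}_{++}$, $$\mathcal{L}_{\delta\gets\gamma}=\max\Bigl\{1,\tfrac{\delta}{\gamma}+\bigl|1-\tfrac{\delta}{\gamma}\bigr|\,\|\mathcal{S}^\dagger\|\sqrt{\textstyle\sum_{i=1}^N\tfrac{(d_i-2d_i^+)^2}{d_i^2}K_i^2}\Bigr\},\qquad K_i:=2\sum_{(h,i)\in\mathcal{E}}\tfrac{K_h}{d_h}+\sqrt{\textstyle\sum_{j=1}^{N-1}S_{ij}^2}\quad(i\in\mathcal{N}).$$ Given $\mathbf{x}_0\in X^{N-1}$, define for $n=0,1,2,\dots$ the sequences $(\mathbf{x}_n)$,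 $(\mathbf{w}_n)$ in $X^{N-1}$ and $(\mathbf{z}_n)$ in $X^N$, with $\mathbf{x}_n=(x_{n,1},\dots,x_{n,N-1})$ and $\mathbf{z}_n=(z_{n,1},\dots,z_{n,N})$, by $$z_{n,i}=J_{\frac{\gamma_n}{d_i}A_i}\Bigl(\tfrac{2}{d_i}\sum_{(h,i)\in\mathcal{E}}z_{n,h}+\tfrac1{d_i}\sum_{j=1}^{N-1}S_{ij}x_{n,j}\Bigr)\quad(i=1,\dots,N),$$ $$\mathbf{w}_n=\mathbf{x}_n-\theta\,\mathcal{S}^*\mathbf{z}_n,$$ $$\mathbf{e}_n=\bigl(d_1z_{n,1},(d_2-2d_2^+)z_{n,2},\dots,(d_N-2d_N^+)z_{n,N}\bigr)-\frac1N\Bigl(d_1z_{n,1}+\sum_{i=2}^N(d_i-2d_i^+)z_{n,i}\Bigr)\mathbf{1},$$ $$\mathbf{x}_{n+1}=\tfrac{\gamma_{n+1}}{\gamma_n}\mathbf{w}_n+\Bigl(1-\tfrac{\gamma_{n+1}}{\gamma_n}\Bigr)\mathcal{S}^\dagger\mathbf{e}_n .$$ Then $(\mathbf{x}_n)_{n\in\mathbb{N}}$ and $(\mathbf{w}_n)_{n\in\mathbb{N}}$ converge weakly to some $\mathbf{x}=(x_1,\dots,x_{N-1})\in\operatorname{Fix}T_{\overline{\gamma}}$ and, for every $i\in\mathcal{N}$, the sequence $(z_{n,i})_{n\in\mathbb{N}}$ converges weakly to the point $z\in\operatorname{zer}\bigl(\sum_{i=1}^NA_i\bigr)$ given by $z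=J_{\frac{\overline{\gamma}}{d_1}A_1}\bigl(\tfrac1{d_1}\sum_{j=1}^{N-1}S_{1j}x_j\bigr)$.
   Context: $\mathbb{R}_{++}$ is the set of positive reals. $J_A=(\mathrm{Id}+A)^{-1}$ is the resolvent of $A$; $\operatorname{zer}A=\{x:0\in Ax\}$; $\operatorname{Fix}T=\{x:Tx=x\}$. Graph data: a directed graph is connected if its underlying undirected graph is; a subgraph $G'=(\mathcal{N},\mathcal{E}')$ has the same nodes and $\mathcal{E}'\subseteq\mathcal{E}$. For $i\in\mathcal{N}$, in $G$: $d_i=|\{j:(i,j)\in\mathcal{E}\text{ or }(j,i)\in\mathcal{E}\}|$ is the degree and $d_i^+=|\{j:(j,i)\in\mathcal{E}\}|$ the in-degree (so $d_1^+=0$). The Laplacian $L\in\mathbb{R}^{N\times N}$ of $G'$ has $L_{ii}$ equal to the degree of $i$ in $G'$, $L_{ij}=-1$ if $(i,j)\in\mathcal{E}'$ or $(j,i)\in\mathcal{E}'$, and $L_{ij}=0$ otherwise. $S\in\mathbb{R}^{N\times(N-1)}$ is a fixed onto decomposition of $L$: $L=SS^*$ with $S^*$ surjective (then $\ker S^*=\operatorname{span}\{(1,\dots,1)\}$). $\mathcal{S}=S\otimes\mathrm{Id}_X\colon X^{N-1}\to X^N$ is $(\mathcal{S}\mathbf{x})_i=\sum_{j=1}^{N-1}S_{ij}x_j$, $\mathcal{S}^*$ is its adjoint and $\mathcal{S}^\dagger$ its Moore–Penrose pseudo-inverse. For $u\in X$, $u\mathbf{1}=(u,\dots,u)\in X^N$.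 Graph-based Douglas–Rachford operator: for $\gamma\in\mathbb{R}_{++}$, $T_\gamma\colon X^{N-1}\to X^{N-1}$ is $T_\gamma\mathbf{x}=\mathbf{x}-\theta\,\mathcal{S}^*\mathbf{z}$, where $\mathbf{z}=(z_1,\dots,z_N)\in X^N$ is given recursively by $z_i=J_{\frac{\gamma}{d_i}A_i}\bigl(\tfrac2{d_i}\sum_{(h,i)\in\mathcal{E}}z_h+\tfrac1{d_i}\sum_{j=1}^{N-1}S_{ij}x_j\bigr)$, $i=1,\dots,N$. *)

(* Defs.v *)
From HB Require Import structures.
From mathcomp Require Import all_boot all_order all_algebra.
From mathcomp Require Import all_classical all_reals all_analysis.
Set Implicit Arguments.
Unset Strict Implicit.
Unset Printing Implicit Defensive.
Import Order.TTheory GRing.Theory Num.Theory.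
Import numFieldNormedType.Exports.
Local Open Scope classical_set_scope.
Local Open Scope ring_scope.

Section InnerProductSpaces.
Context {R : realType}.

(* Convergence for the initial topology of the functionals [dU ^~ v], which on a
   Hilbert space is the weak topology. *)
Definition weakly_converges {U : lmodType R} (dU : {dot U for idfun})
    (u : nat -> U) (l : U) : Prop :=
  forall v : U, (fun n => dU (u n) v) @ \oo --> dU l v.

Definition dot_norm {U : lmodType R} (dU : {dot U for idfun}) (u : U) : R :=
  Num.sqrt (dU u u).

Definition operator_norm {U V : lmodType R} (dU : {dot U for idfun})
    (dV : {dot V for idfun}) (T : U -> V) : R :=
  sup [set dot_norm dV (T u) | u in [set u | dot_norm dU u <= 1]].

Definition is_adjoint {U V : lmodType R} (dU : {dot U for idfun})
    (dV : {dot V for idfun}) (T : U -> V) (T' : V -> U) : Prop :=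
  forall u v, dV (T u) v = dU u (T' v).

Definition adjoint {U V : lmodType R} (dU : {dot U for idfun})
    (dV : {dot V for idfun}) (T : U -> V) : V -> U :=
  xget (fun=> 0) [set T' | is_adjoint dU dV T T'].

(* The four Penrose equations. *)
Definition is_pseudo_inverse {U V : lmodType R} (dU : {dot U for idfun})
    (dV : {dot V for idfun}) (T : U -> V) (T' : V -> U) : Prop :=
  [/\ forall u, T (T' (T u)) = T u,
      forall v, T' (T (T' v)) = T' v,
      is_adjoint dV dV (T \o T') (T \o T') &
      is_adjoint dU dU (T' \o T) (T' \o T)].

Definition pseudo_inverse {U V : lmodType R} (dU : {dot U for idfun})
    (dV : {dot V for idfun}) (T : U -> V) : V -> U :=
  xget (fun=> 0) [set T' | is_pseudo_inverse dU dV T T'].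

Section DotTheory.
Context {U : lmodType R} (dU : {dot U for idfun}).

Lemma dot_inj (u v : U) : (forall w, dU u w = dU v w) -> u = v.
Proof.
move=> uv; apply/eqP; rewrite -subr_eq0; apply/negPn/negP => uv0.
have := @neq0_dnorm_gt0 _ _ _ dU _ uv0.
by rewrite linearBl /= uv subrr ltxx.
Qed.

Lemma dotC (u v : U) : dU u v = dU v u.
Proof. by rewrite hermC /= expr0 mul1r. Qed.

Lemma dot_ge0 (u : U) : 0 <= dU u u.
Proof.
have [->|u0] := eqVneq u 0; first by rewrite linear0r.
exact/ltW/neq0_dnorm_gt0.
Qed.

Lemma dot_injr (u v : U) : (forall w, dU w u = dU w v) -> u = v.
Proof. by move=> uv; apply: dot_inj => w; rewrite dotC uv dotC. Qed.
End DotTheory.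

Lemma is_adjoint_unique {U V : lmodType R} (dU : {dot U for idfun})
    (dV : {dot V for idfun}) (T : U -> V) (T1 T2 : V -> U) :
  is_adjoint dU dV T T1 -> is_adjoint dU dV T T2 -> T1 = T2.
Proof.
by move=> h1 h2; apply/funext => v; apply: (@dot_injr _ dU) => u; rewrite -h1 -h2.
Qed.

Lemma adjointP {U V : lmodType R} (dU : {dot U for idfun})
    (dV : {dot V for idfun}) (T : U -> V) (T' : V -> U) :
  is_adjoint dU dV T T' -> adjoint dU dV T = T'.
Proof.
by move=> h; apply: is_adjoint_unique (h); apply: (xgetPex _ (ex_intro _ _ h)).
Qed.

Lemma is_pseudo_inverse_unique {U V : lmodType R} (dU : {dot U for idfun})
    (dV : {dot V for idfun}) (T : U -> V) (T1 T2 : V -> U) :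
  is_pseudo_inverse dU dV T T1 -> is_pseudo_inverse dU dV T T2 -> T1 = T2.
Proof.
move=> [a1 b1 c1 d1] [a2 b2 c2 d2].
have TT v : T (T1 v) = T (T2 v).
  apply: (@dot_inj _ dV) => w.
  transitivity (dV (T (T2 (T (T1 v)))) w); first by rewrite a2.
  rewrite [LHS](c2 (T (T1 v)) w) [LHS](c1 v (T (T2 w))) /= a1.
  by rewrite -[LHS](c2 v w).
have SS u : T1 (T u) = T2 (T u).
  apply: (@dot_inj _ dU) => w.
  transitivity (dU (T1 (T (T2 (T u)))) w); first by rewrite a2.
  rewrite [LHS](d1 (T2 (T u)) w) [LHS](d2 u (T1 (T w))) /= a1.
  by rewrite -[LHS](d2 u w).
by apply/funext => v; rewrite -b1 TT SS b2.
Qed.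

Lemma pseudo_inverseP {U V : lmodType R} (dU : {dot U for idfun})
    (dV : {dot V for idfun}) (T : U -> V) (T' : V -> U) :
  is_pseudo_inverse dU dV T T' -> pseudo_inverse dU dV T = T'.
Proof.
move=> h; apply: is_pseudo_inverse_unique (h).
exact: (xgetPex _ (ex_intro _ _ h)).
Qed.

End InnerProductSpaces.

Section ProductSpaces.
Context {R : realType} {X : lmodType R} (dot : {dot X for idfun}).

Definition prod_dot (n : nat) (x y : 'I_n -> X) : R := \sum_i dot (x i) (y i).

Section Instances.
Variable n : nat.

Let prod_dot_bilinear :
  bilinear_for *%R (idfun \; *%R : R -> R -> R) (@prod_dot n).
Proof.
split=> [y a x x'|x a y y'] /=; rewrite /prod_dot mulr_sumr -big_split /=.
  by apply: eq_bigr => i _; rewrite linearPl.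
by apply: eq_bigr => i _; rewrite linearPr.
Qed.

HB.instance Definition _ := @bilinear_isBilinear.Build R ('I_n -> X) ('I_n -> X) R
  *%R (idfun \; *%R : R -> R -> R) (@prod_dot n) prod_dot_bilinear.

Let prod_dot_sym (x y : 'I_n -> X) :
  @prod_dot n x y = (-1) ^+ false * idfun (@prod_dot n y x).
Proof.
by rewrite expr0 mul1r; apply: eq_bigr => i _; rewrite dotC.
Qed.

HB.instance Definition _ := @isHermitianSesquilinear.Build R ('I_n -> X)
  false idfun (@prod_dot n) prod_dot_sym.

Let prod_dot_gt0 (x : 'I_n -> X) : x != 0 -> 0 < @prod_dot n x x.
Proof.
move=> x0; have [i xi0] : exists i, x i != 0.
  apply: contrapT => /forallNP xi; case/eqP: x0; apply/funext => i.
  by apply/eqP; move/negP: (xi i); rewrite negbK.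
rewrite /prod_dot (bigD1 i) //=; apply: ltr_pwDl; first exact: neq0_dnorm_gt0.
by apply: sumr_ge0 => j _; exact: dot_ge0.
Qed.

HB.instance Definition _ :=
  @isDotProduct.Build R ('I_n -> X) (@prod_dot n) prod_dot_gt0.

End Instances.

Definition tensor_id (m n : nat) (S : 'M[R]_(m, n)) (x : 'I_n -> X) : 'I_m -> X :=
  fun i => \sum_j S i j *: x j.

Lemma tensor_id_mul (m n p : nat) (S : 'M[R]_(m, n)) (S' : 'M[R]_(n, p))
    (x : 'I_p -> X) :
  tensor_id S (tensor_id S' x) = tensor_id (S *m S') x.
Proof.
apply/funext => i; rewrite /tensor_id.
under eq_bigr do rewrite scaler_sumr.
rewrite exchange_big /=; apply: eq_bigr => k _; rewrite mxE scaler_suml.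
by apply: eq_bigr => j _; rewrite scalerA.
Qed.

Lemma tensor_id1 (n : nat) (x : 'I_n -> X) : tensor_id 1%:M x = x.
Proof.
apply/funext => i; rewrite /tensor_id (bigD1 i) //= mxE eqxx scale1r big1 ?addr0//.
by move=> j ji; rewrite mxE eq_sym (negbTE ji) scale0r.
Qed.

Lemma is_adjoint_tensor_id (m n : nat) (S : 'M[R]_(m, n)) :
  is_adjoint (prod_dot (n:=n)) (prod_dot (n:=m)) (tensor_id S) (tensor_id S^T).
Proof.
move=> x y; rewrite /= /prod_dot /tensor_id.
under eq_bigr do rewrite linear_sumlz.
under [RHS]eq_bigr do rewrite linear_sumr.
rewrite exchange_big /=; apply: eq_bigr => j _; apply: eq_bigr => i _.
by rewrite linearZl linearZr_LR /= mxE.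
Qed.

Lemma adjoint_tensor_id (m n : nat) (S : 'M[R]_(m, n)) :
  adjoint (prod_dot (n:=n)) (prod_dot (n:=m)) (tensor_id S) = tensor_id S^T.
Proof. exact/adjointP/is_adjoint_tensor_id. Qed.

Lemma pseudo_inverse_tensor_id (m n : nat) (S : 'M[R]_(m, n)) :
  S^T *m S \in unitmx ->
  pseudo_inverse (prod_dot (n:=n)) (prod_dot (n:=m)) (tensor_id S) =
    tensor_id (invmx (S^T *m S) *m S^T).
Proof.
move=> uS; set B := invmx _ *m _.
have BS : B *m S = 1%:M by rewrite -mulmxA mulVmx.
apply: pseudo_inverseP; split.
- by move=> x; rewrite (tensor_id_mul B S) BS tensor_id1.
- by move=> x; rewrite (tensor_id_mul B S) BS tensor_id1.
- have -> : tensor_id S \o tensor_id B = tensor_id (S *m B).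
    by apply/funext => x /=; rewrite tensor_id_mul.
  have {2}-> : S *m B = (S *m B)^T.
    by rewrite /B !trmx_mul trmxK trmx_inv trmx_mul trmxK !mulmxA.
  exact: is_adjoint_tensor_id.
- have -> : tensor_id B \o tensor_id S = id.
    by apply/funext => x /=; rewrite tensor_id_mul BS tensor_id1.
  by [].
Qed.

End ProductSpaces.

Section MonotoneOperators.
Context {R : realType} {X : lmodType R} (dot : {dot X for idfun}).

Definition monotone_operator (A : X -> set X) : Prop :=
  forall x y u v, A x u -> A y v -> 0 <= dot (x - y) (u - v).

Definition maximally_monotone (A : X -> set X) : Prop :=
  monotone_operator A /\
  forall B : X -> set X, monotone_operator B -> (forall x, A x `<=` B x) ->
    forall x, B x `<=` A x.

Definition zer (A : X -> set X) : set X := [set x | A x 0].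

Definition sum_operator (n : nat) (A : 'I_n -> X -> set X) : X -> set X :=
  fun x => [set u | exists a : 'I_n -> X,
                      (forall i, A i x (a i)) /\ u = \sum_i a i].

Definition scale_operator (c : R) (A : X -> set X) : X -> set X :=
  fun x => [set c *: u | u in A x].

Definition resolvent_graph (A : X -> set X) : X -> set X :=
  fun x => [set y | exists2 u, A y u & x = y + u].

(* For [A] maximally monotone, [(Id + A)^-1] is single-valued with full domain; the
   default value 0 is used elsewhere. *)
Definition resolvent (A : X -> set X) (x : X) : X := xget 0 (resolvent_graph A x).

Lemma resolvent_graph_unique (A : X -> set X) (x y y' : X) :
  monotone_operator A -> resolvent_graph A x y -> resolvent_graph A x y' -> y = y'.
Proof.
move=> mA [u yu xE] [u' yu' xE']; have := mA _ _ _ _ yu yu'.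
have -> : u - u' = - (y - y').
  by apply/eqP; rewrite eq_sym opprB subr_eq addrAC eq_sym subr_eq -[y' + _]addrC
    addrC -xE xE' addrC.
rewrite linearNr /= oppr_ge0 => le0; apply/eqP; rewrite -subr_eq0.
apply/negPn/negP => y0.
by have := lt_le_trans (neq0_dnorm_gt0 (s := dot) _ y0) le0; rewrite ltxx.
Qed.

End MonotoneOperators.

Section Graphs.
Context {R : realType} {N : nat}.

Definition graph_connected (E : rel 'I_N) : Prop :=
  forall i j, connect (fun h k => E h k || E k h) i j.

Definition degree (E : rel 'I_N) (i : 'I_N) : nat := #|[set j | E i j || E j i]%SET|.

Definition in_degree (E : rel 'I_N) (i : 'I_N) : nat := #|[set j | E j i]%SET|.

Definition laplacian (E : rel 'I_N) : 'M[R]_N :=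
  \matrix_(i, j) if i == j then (degree E i)%:R
                 else if E i j || E j i then -1 else 0.

Definition onto_decomposition (p : nat) (L : 'M[R]_N) (S : 'M[R]_(N, p)) : Prop :=
  L = S *m S^T /\ forall y : 'cV[R]_p, exists x : 'cV[R]_N, S^T *m x = y.

(* Solution of [f = F f] when [F f i] depends only on the values of [f] at the
   [E]-predecessors of [i] and edges increase the index. *)
Definition graph_recursion (V : lmodType R) (F : ('I_N -> V) -> 'I_N -> V) :
  'I_N -> V := iter N F (fun=> 0).

Lemma graph_recursionE (E : rel 'I_N) (V : lmodType R)
    (F : ('I_N -> V) -> 'I_N -> V) :
  (forall i j, E i j -> (i < j)%N) ->
  (forall f g i, (forall h, E h i -> f h = g h) -> F f i = F g i) ->
  F (graph_recursion F) = graph_recursion F.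
Proof.
move=> Elt Fext.
have stab n : forall i : 'I_N, (i < n)%N ->
    iter n.+1 F (fun=> 0) i = iter n F (fun=> 0) i.
  elim: n => // n IH i lein; rewrite !iterS; apply: Fext => h Ehi.
  by apply: IH; exact: leq_trans (Elt _ _ Ehi) lein.
by apply/funext => i; exact: stab.
Qed.

End Graphs.

Section DouglasRachford.
Context {R : realType} {X : lmodType R} (dot : {dot X for idfun}).
Context {N p : nat} (E : rel 'I_N) (S : 'M[R]_(N, p)).

Definition K_const : 'I_N -> R :=
  graph_recursion (V := R^o) (fun K i =>
    2 * (\sum_(h | E h i) K h / (degree E h)%:R) + Num.sqrt (\sum_j S i j ^+ 2)).

(* [relocation_const delta gamma] is the constant with subscript
   [delta <- gamma]. *)
Definition relocation_const (delta gamma : R) : R :=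
  Num.max 1 (delta / gamma +
    `|1 - delta / gamma|
    * operator_norm (prod_dot dot (n:=N)) (prod_dot dot (n:=p))
        (pseudo_inverse (prod_dot dot (n:=p)) (prod_dot dot (n:=N)) (tensor_id S))
    * Num.sqrt (\sum_i ((degree E i)%:R - 2 * (in_degree E i)%:R) ^+ 2
                        / (degree E i)%:R ^+ 2 * K_const i ^+ 2)).

Definition dr_step (A : 'I_N -> X -> set X) (gamma : R) (x : 'I_p -> X)
    (z : 'I_N -> X) : 'I_N -> X :=
  fun i => resolvent (scale_operator (gamma / (degree E i)%:R) (A i))
    ((2 / (degree E i)%:R) *: (\sum_(h | E h i) z h)
     + (degree E i)%:R^-1 *: (\sum_j S i j *: x j)).

Definition dr_shadow (A : 'I_N -> X -> set X) (gamma : R) (x : 'I_p -> X) :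
  'I_N -> X := graph_recursion (dr_step A gamma x).

Definition dr_operator (A : 'I_N -> X -> set X) (theta gamma : R)
    (x : 'I_p -> X) : 'I_p -> X :=
  x - theta *: adjoint (prod_dot dot (n:=p)) (prod_dot dot (n:=N)) (tensor_id S)
                 (dr_shadow A gamma x).

Lemma K_constE (i : 'I_N) :
  (forall i j, E i j -> (i < j)%N) ->
  K_const i = 2 * (\sum_(h | E h i) K_const h / (degree E h)%:R)
              + Num.sqrt (\sum_j S i j ^+ 2).
Proof.
move=> Elt; rewrite /K_const -[in LHS](graph_recursionE Elt) // => f g k fg.
by congr (_ * _ + _); apply: eq_bigr => h Ehk; rewrite fg.
Qed.

Lemma dr_shadowE (A : 'I_N -> X -> set X) (gamma : R) (x : 'I_p -> X) (i : 'I_N) :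
  (forall i j, E i j -> (i < j)%N) ->
  dr_shadow A gamma x i =
    resolvent (scale_operator (gamma / (degree E i)%:R) (A i))
      ((2 / (degree E i)%:R) *: (\sum_(h | E h i) dr_shadow A gamma x h)
       + (degree E i)%:R^-1 *: (\sum_j S i j *: x j)).
Proof.
move=> Elt; rewrite /dr_shadow -[in LHS](graph_recursionE Elt) // => f g k fg.
rewrite /dr_step; congr (resolvent _ (_ *: _ + _)).
by apply: eq_bigr => h Ehk; rewrite fg.
Qed.

End DouglasRachford.

(* Main.v *)
Require Import Defs.
From HB Require Import structures.
From mathcomp Require Import all_boot all_order all_algebra.
From mathcomp Require Import all_classical all_reals all_analysis.
From mathcomp Require Import ring lra.
Set Implicit Arguments.
Unset Strict Implicit.
Unset Printing Implicit Defensive.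
Import Order.TTheory GRing.Theory Num.Theory.
Import numFieldNormedType.Exports.
Local Open Scope classical_set_scope.
Local Open Scope ring_scope.

(** Write [z] for the shadow of [x] at parameter [g], i.e. the solution of the
    recursion. Maximal monotonicity and Minty's theorem ([Minty]) turn the recursion
    into the inclusions
    [2 \sum_(h -> i) z h + (S x) i - d i z i \in g A i (z i)] ([dr_inclusionP]).

    Fixed points. [x] is a fixed point exactly when [S^* z = 0], that is, when all
    the [z i] equal one point [u]; then [u] is a zero of the sum of the [A i] and
    [x = S^+ e + g S^+ a], where [e i = (d i - 2 d^+ i) u] and the [a i \in A i u] add
    up to zero ([dr_inclusion_const], [dr_inclusion_const_inv]). For fixed [u] and [a]
    this is an affine function [q] of [g]. The update of the algorithm is designed
    to send [q (gamma n)] to [q (gamma n.+1)].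

    Estimates. Subtracting the inclusions of two points and summing gives
    [<S^* dz, dx> >= \sum_(h -> i) |dz h - dz i|^2 >= |S^* dz|^2], the last sum over
    the subgraph being the quadratic form of its Laplacian [S S^*]. Hence one
    Douglas-Rachford step is averaged ([dr_averaged]). The shadow is Lipschitz with
    constants [K i / d i] ([shadow_lipschitz]), so a whole relocated step from
    [gamma n] to [gamma n.+1] has Lipschitz constant [relocation_const]. As the sum
    of [relocation_const - 1] is finite, [|x n - q (gamma n)|] converges
    ([moving_distance_cvg]); so does the distance to the fixed point [q gammabar]
    ([distance_cvg]), and [S^* (z n)] tends to zero ([adjoint_cvg0]).

    Limits. By Opial's argument ([Opial]) it remains to see that weak limits of
    [x n] are fixed points for [gammabar]. They are taken along ultrafilters, where
    bounded sequences always have a weak limit ([bounded_weak_limit]). Since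
    [S^* (z n)] tends to zero, the entries of [z n] have a common weak limit, and the
    pairing of [z n] with the elements of [A i (z n i)] passes to the limit; the
    inclusions therefore hold at the limit ([dr_inclusion_demiclosed]). *)

(** * Inner products *)

Section InnerProduct.
Context {R : realType} {U : lmodType R} (dU : {dot U for idfun}).
Implicit Types u v w : U.

Lemma dotDl u v w : dU (u + v) w = dU u w + dU v w.
Proof. exact: linearDl. Qed.

Lemma dotDr u v w : dU w (u + v) = dU w u + dU w v.
Proof. exact: linearDr. Qed.

Lemma dotNl u w : dU (- u) w = - dU u w.
Proof. exact: linearNl. Qed.

Lemma dotNr u w : dU w (- u) = - dU w u.
Proof. exact: linearNr. Qed.

Lemma dotBl u v w : dU (u - v) w = dU u w - dU v w.
Proof. by rewrite dotDl dotNl. Qed.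

Lemma dotBr u v w : dU w (u - v) = dU w u - dU w v.
Proof. by rewrite dotDr dotNr. Qed.

Lemma dotZl a u w : dU (a *: u) w = a * dU u w.
Proof. exact: linearZl. Qed.

Lemma dotZr a u w : dU w (a *: u) = a * dU w u.
Proof. exact: linearZr_LR. Qed.

Lemma dot0l w : dU 0 w = 0.
Proof. exact: linear0l. Qed.

Lemma dot0r w : dU w 0 = 0.
Proof. exact: linear0r. Qed.

Lemma dot_suml (I : Type) (r : seq I) (P : pred I) (F : I -> U) w :
  dU (\sum_(i <- r | P i) F i) w = \sum_(i <- r | P i) dU (F i) w.
Proof. exact: linear_sumlz. Qed.

Lemma dot_sumr (I : Type) (r : seq I) (P : pred I) (F : I -> U) w :
  dU w (\sum_(i <- r | P i) F i) = \sum_(i <- r | P i) dU w (F i).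
Proof. exact: linear_sumr. Qed.

Definition dotE := (dotDl, dotDr, dotNl, dotNr, dotZl, dotZr, dot0l, dot0r).

Lemma dot_eq0 u : dU u u = 0 -> u = 0.
Proof.
move=> u0; apply/eqP/negPn/negP => /(@neq0_dnorm_gt0 _ _ _ dU).
by rewrite u0 ltxx.
Qed.

Lemma dot_norm_ge0 u : 0 <= dot_norm dU u.
Proof. exact: sqrtr_ge0. Qed.

Lemma sqr_dot_norm u : dot_norm dU u ^+ 2 = dU u u.
Proof. by rewrite sqr_sqrtr ?dot_ge0. Qed.

Lemma sqr_dot_normB u v :
  dot_norm dU (u - v) ^+ 2
  = dot_norm dU u ^+ 2 - 2 * dU u v + dot_norm dU v ^+ 2.
Proof. by rewrite !sqr_dot_norm !dotE (dotC _ v u); ring. Qed.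

Lemma dot_norm0 : dot_norm dU 0 = 0.
Proof. by rewrite /dot_norm dot0l sqrtr0. Qed.

Lemma dot_norm_eq0 u : dot_norm dU u = 0 -> u = 0.
Proof. by move=> u0; apply: dot_eq0; rewrite -sqr_dot_norm u0 expr0n. Qed.

Lemma dot_normZ a u : dot_norm dU (a *: u) = `|a| * dot_norm dU u.
Proof.
by rewrite /dot_norm dotZl dotZr mulrA -expr2 sqrtrM ?sqr_ge0// sqrtr_sqr.
Qed.

Lemma dot_normN u : dot_norm dU (- u) = dot_norm dU u.
Proof. by rewrite -scaleN1r dot_normZ normrN1 mul1r. Qed.

Lemma dot_normBC u v : dot_norm dU (u - v) = dot_norm dU (v - u).
Proof. by rewrite -dot_normN opprB. Qed.

Lemma dot_le_norm u v : dU u v <= dot_norm dU u * dot_norm dU v.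
Proof.
have [u0|u0] := eqVneq (dot_norm dU u) 0.
  by rewrite u0 mul0r (dot_norm_eq0 u0) dot0l.
have [v0|v0] := eqVneq (dot_norm dU v) 0.
  by rewrite v0 mulr0 (dot_norm_eq0 v0) dot0r.
have ab0 : 0 < dot_norm dU u * dot_norm dU v.
  by rewrite mulr_gt0// lt_neqAle eq_sym dot_norm_ge0 ?u0 ?v0.
have := dot_ge0 dU (dot_norm dU v *: u - dot_norm dU u *: v).
rewrite !dotE -!sqr_dot_norm (dotC _ v u) => h; nra.
Qed.

Lemma CauchySchwarz_dot u v : `|dU u v| <= dot_norm dU u * dot_norm dU v.
Proof.
rewrite ler_norml dot_le_norm andbT lerNl -dotNl.
by rewrite -[X in X * _]dot_normN dot_le_norm.
Qed.

Lemma dot_normD u v : dot_norm dU (u + v) <= dot_norm dU u + dot_norm dU v.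
Proof.
rewrite -[leRHS]ger0_norm ?addr_ge0 ?dot_norm_ge0// -sqrtr_sqr ler_wsqrtr//.
rewrite sqrrD !sqr_dot_norm !dotE (dotC _ v u).
have := dot_le_norm u v; lra.
Qed.

Lemma dot_normB u v w :
  dot_norm dU (u - w) <= dot_norm dU (u - v) + dot_norm dU (v - w).
Proof. by apply: le_trans (dot_normD _ _); rewrite addrA subrK. Qed.

Lemma ler_dist_dot_norm u v :
  `|dot_norm dU u - dot_norm dU v| <= dot_norm dU (u - v).
Proof.
rewrite ler_norml.
have := dot_normD (u - v) v; have := dot_normD (v - u) u.
rewrite !subrK (dot_normBC v) => h1 h2; apply/andP; split; lra.
Qed.

Lemma dot_norm_sum (I : Type) (r : seq I) (P : pred I) (F : I -> U) :
  dot_norm dU (\sum_(i <- r | P i) F i)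
  <= \sum_(i <- r | P i) dot_norm dU (F i).
Proof.
elim/big_ind2 : _ => [|u a v b ua vb|//]; first by rewrite dot_norm0.
exact: le_trans (dot_normD _ _) (lerD ua vb).
Qed.

End InnerProduct.

Section Strong.
Context {R : realType} {U : lmodType R} (dU : {dot U for idfun}).
Context {T : Type} (F : set_system T) {FF : Filter F}.
Implicit Types (u v : T -> U) (l k : U).

(** Convergence in norm along a filter, stated without a topology on [U]: this is
    what makes the same lemmas usable on [X] and on the powers of [X]. *)
Definition strongly_converges u l : Prop :=
  dot_norm dU (u t - l) @[t --> F] --> 0.

Lemma cvg0_le (f g : T -> R) :
  (forall t, 0 <= f t <= g t) -> g @ F --> 0 -> f @ F --> 0.
Proof.
move=> fg g0; apply: squeeze_cvgr (cvg_cst _) g0; exact: nearW.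
Qed.

Lemma cvg0M (f g : T -> R) (b : R) :
  f @ F --> 0 -> g @ F --> b -> f t * g t @[t --> F] --> 0.
Proof. by move=> f0 gb; rewrite -(mul0r b); exact: cvgM. Qed.

Lemma cvg_dist_le (f g : T -> R) (a : R) :
  (forall t, `|f t - a| <= g t) -> g @ F --> 0 -> f @ F --> a.
Proof.
move=> fg g0; apply: (@squeeze_cvgr _ F _ _ (fun t => a - g t) (fun t => a + g t)).
- by apply: nearW => t; rewrite -ler_distl.
- by rewrite -[X in _ --> X]subr0; apply: cvgB g0; exact: cvg_cst.
- by rewrite -[X in _ --> X]addr0; apply: cvgD g0; exact: cvg_cst.
Qed.

Lemma cvg_sumr (I : Type) (r : seq I) (P : pred I) (f : I -> T -> R) (a : I -> R) :
  (forall i, P i -> f i @ F --> a i) ->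
  (\sum_(i <- r | P i) f i t) @[t --> F] --> \sum_(i <- r | P i) a i.
Proof.
move=> fa; elim: r => [|i r IH].
  by rewrite big_nil; under eq_fun do rewrite big_nil; exact: cvg_cst.
rewrite big_cons; under eq_fun do rewrite big_cons.
by case: ifP => // /fa fai; exact: cvgD.
Qed.

Lemma strongly_converges_dot u v l k :
  strongly_converges u l -> strongly_converges v k ->
  dU (u t) (v t) @[t --> F] --> dU l k.
Proof.
move=> ul vk.
have h : (dot_norm dU (u t - l) * dot_norm dU (v t - k)
          + dot_norm dU (u t - l) * dot_norm dU k
          + dot_norm dU l * dot_norm dU (v t - k)) @[t --> F] --> (0 : R).
  have -> : 0 = 0 * 0 + 0 * dot_norm dU k + dot_norm dU l * 0 :> R by ring.
  apply: cvgD; first apply: cvgD.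
  - exact: cvgM ul vk.
  - exact: cvgM ul (cvg_cst _).
  - exact: cvgM (cvg_cst _) vk.
apply: cvg_dist_le h => t.
have -> : dU (u t) (v t) - dU l k
   = dU (u t - l) (v t - k) + dU (u t - l) k + dU l (v t - k).
  by rewrite !dotE; ring.
apply: le_trans (ler_normD _ _) _; apply: lerD; last exact: CauchySchwarz_dot.
by apply: le_trans (ler_normD _ _) _; apply: lerD; exact: CauchySchwarz_dot.
Qed.

End Strong.

(** * Minimisation in a complete inner product space *)

Section Completeness.
Context {R : realType}.

Definition complete_dot {U : lmodType R} (dU : {dot U for idfun}) : Prop :=
  forall u : nat -> U,
    (forall eps : R, 0 < eps -> exists M, forall m n : nat, (M <= m)%N ->
       (M <= n)%N -> dot_norm dU (u m - u n) <= eps) ->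
    exists l, strongly_converges dU \oo u l.

Lemma complete_dot_normed {X : completeNormedModType R} (dot : {dot X for idfun}) :
  (forall u : X, `|u| ^+ 2 = dot u u) -> complete_dot dot.
Proof.
move=> hdot u ucauchy.
have normE v : dot_norm dot v = `|v|.
  by rewrite /dot_norm -hdot sqrtr_sqr normr_id.
have /cvg_ex[/= l ul] : cvg (u @ \oo).
  apply/cauchy_cvgP/cauchy_exP => eps eps0.
  have [M hM] := ucauchy (eps / 2) (divr_gt0 eps0 (ltr0Sn _ 1)).
  exists (u M); exists M => // n /= Mn; rewrite -ball_normE /=.
  apply: le_lt_trans (_ : eps / 2 < eps); last by lra.
  by rewrite -normE hM.
exists l; rewrite /strongly_converges.
under eq_fun do rewrite normE.
by apply/norm_cvg0P; rewrite -(subrr l); apply: cvgB => //; exact: cvg_cst.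
Qed.

Section Power.
Context {U : lmodType R} (dU : {dot U for idfun}) {n : nat}.
Implicit Type x : 'I_n -> U.

Lemma dot_norm_coord x i : dot_norm dU (x i) <= dot_norm (prod_dot dU (n:=n)) x.
Proof.
rewrite ler_wsqrtr//= /prod_dot (bigD1 i)//= lerDl sumr_ge0// => j _.
exact: dot_ge0.
Qed.

Lemma prod_dot_norm_le x :
  dot_norm (prod_dot dU (n:=n)) x <= \sum_i dot_norm dU (x i).
Proof.
have s0 : 0 <= \sum_i dot_norm dU (x i).
  by apply: sumr_ge0 => i _; exact: dot_norm_ge0.
rewrite -[leRHS]ger0_norm// -sqrtr_sqr ler_wsqrtr//= /prod_dot.
have [] // : 0 <= \sum_i dot_norm dU (x i) /\
  \sum_i dU (x i) (x i) <= (\sum_i dot_norm dU (x i)) ^+ 2.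
elim/big_ind2 : _ => [|a A b B [a0 aA] [b0 bB]|i _].
- by rewrite expr0n.
- by split; nra.
- by rewrite dot_norm_ge0 sqr_dot_norm.
Qed.

Lemma strongly_converges_coord {T : Type} (F : set_system T) {FF : Filter F}
    (u : T -> 'I_n -> U) l i :
  strongly_converges (prod_dot dU (n:=n)) F u l ->
  strongly_converges dU F (u ^~ i) (l i).
Proof.
by apply: cvg0_le => t; rewrite dot_norm_ge0 (dot_norm_coord (u t - l)).
Qed.

Lemma complete_prod_dot : complete_dot dU -> complete_dot (prod_dot dU (n:=n)).
Proof.
move=> cU u ucauchy.
have /choice[l ul] i : exists l, strongly_converges dU \oo (u ^~ i) l.
  apply: cU => eps /ucauchy[M hM]; exists M => j k Mj Mk.
  exact: le_trans (dot_norm_coord (u j - u k) i) (hM _ _ Mj Mk).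
exists l; apply: cvg0_le (_ : (\sum_i dot_norm dU (u k i - l i)) @[k --> \oo] --> 0).
  by move=> k; rewrite dot_norm_ge0 (prod_dot_norm_le (u k - l)).
rewrite -[X in _ --> X](_ : \sum_(i < n) 0 = 0); last by rewrite big1.
by apply: cvg_sumr => i _; exact: ul.
Qed.

End Power.

Section Minimisation.
Context {U : lmodType R} (dU : {dot U for idfun}) (cU : complete_dot dU).

(** [C] plays the epigraph of a closed convex function [f], and [(u, t)] the
    minimiser of the strongly convex function [f + |.|^2 / 2] with its value
    [t = f u]. By the parallelogram identity a minimising sequence is Cauchy, and
    the conclusion is the first order condition [- u \in \partial f u]. *)
Lemma epigraph_minimizer (C : U -> R -> Prop) (m : R) :
  (exists u t, C u t) ->
  (forall u v s t (a : R), 0 <= a <= 1 -> C u s -> C v t ->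
     C ((1 - a) *: u + a *: v) ((1 - a) * s + a * t)) ->
  (forall (u : nat -> U) (t : nat -> R) l k, (forall n, C (u n) (t n)) ->
     strongly_converges dU \oo u l -> t @ \oo --> k -> C l k) ->
  (forall u t, C u t -> m <= t + dU u u / 2) ->
  exists u t, C u t /\ forall v s, C v s -> 0 <= s - t + dU u (v - u).
Proof.
move=> [u0 [t0 C0]] convC closC bndC.
pose g (p : U * R) := p.2 + dU p.1 p.1 / 2.
pose G := [set g p | p in [set p | C p.1 p.2]].
have hG : has_inf G.
  split; first by exists (g (u0, t0)); exists (u0, t0).
  by exists m => _ [p Cp <-]; exact: bndC.
pose mu := inf G.
have mule u t : C u t -> mu <= t + dU u u / 2.
  by move=> Cut; apply: ge_inf; [exact: (proj2 hG) | exists (u, t)].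
have /choice[p hp] n : exists p : U * R, C p.1 p.2 /\ g p <= mu + n.+1%:R^-1.
  have n0 : 0 < n.+1%:R^-1 :> R by rewrite invr_gt0.
  have [_ [p Cp <-] gp] := inf_adherent n0 hG.
  by exists p; split => //; exact: ltW.
have parallelogram i j : dot_norm dU ((p i).1 - (p j).1) ^+ 2
    <= 4 * (i.+1%:R^-1 + j.+1%:R^-1).
  have [Ci gi] := hp i; have [Cj gj] := hp j.
  have half : 0 <= (2^-1 : R) <= 1 by apply/andP; split; lra.
  have := mule _ _ (convC _ _ _ _ _ half Ci Cj).
  move: gi gj; rewrite sqr_dot_norm /g !dotE (dotC _ (p j).1 (p i).1).
  move: (i.+1%:R^-1) (j.+1%:R^-1) (dU _ _) (dU _ _) (dU _ _) => a b A B D.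
  lra.
have [l pl] : exists l, strongly_converges dU \oo (fun n => (p n).1) l.
  apply: cU => eps eps0.
  have e0 : 0 < eps ^+ 2 / 8 by rewrite divr_gt0// exprn_gt0.
  have [M _ hM] := near_infty_natSinv_lt (PosNum e0).
  exists M => i j Mi Mj.
  rewrite -ler_sqr ?nnegrE ?dot_norm_ge0 ?(ltW eps0)//.
  apply: le_trans (parallelogram i j) _.
  have hi : i.+1%:R^-1 < eps ^+ 2 / 8 := hM _ Mi.
  have hj : j.+1%:R^-1 < eps ^+ 2 / 8 := hM _ Mj.
  move: (i.+1%:R^-1) (j.+1%:R^-1) hi hj => a b; lra.
pose k := mu - dU l l / 2.
have pk : (p n).2 @[n --> \oo] --> k.
  rewrite (_ : (fun n => (p n).2) = fun n => g (p n) - dU (p n).1 (p n).1 / 2).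
    apply: cvgB.
      2: by apply: cvgM (cvg_cst _); exact: strongly_converges_dot.
    apply: cvg_dist_le (@cvg_harmonic R) => n.
    have [Cn gn] := hp n; rewrite ger0_norm ?subr_ge0; last exact: mule.
    by rewrite lerBlDl.
  by apply/funext => n; rewrite /g addrK.
have Clk : C l k by apply: closC pl pk => n; exact: (proj1 (hp n)).
exists l, k; split=> // v s Cvs.
set D := s - k + _; set Q := dU (v - l) (v - l).
have Q0 : 0 <= Q by exact: dot_ge0.
rewrite leNgt; apply/negP => D0.
(* a step on the segment from [l] to [v] short enough for the first order
   decrease [a * D] to beat the second order term [a ^+ 2 * Q / 2] *)
pose a := - D / (Q + 1 - D).
have den0 : 0 < Q + 1 - D by lra.
have aden : a * (Q + 1 - D) = - D by rewrite /a divfK// gt_eqF.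
have a0 : 0 < a by rewrite divr_gt0// oppr_gt0.
have a1 : a <= 1 by rewrite ler_pdivrMr// mul1r; lra.
have a01 : 0 <= a <= 1 by rewrite ltW.
have := mule _ _ (convC _ _ _ _ _ a01 Clk Cvs).
have -> : (1 - a) * k + a * s
    + dU ((1 - a) *: l + a *: v) ((1 - a) *: l + a *: v) / 2
    = mu + a * (D + a * Q / 2).
  by rewrite /D /Q /k !dotE (dotC _ v l); field.
rewrite lerDl pmulr_rge0// => h.
nra.
Qed.

(** The representing vector minimises [|u|^2 / 2 - f u]. *)
Lemma Riesz (f : U -> R) (M : R) :
  (forall a u v, f (a *: u + v) = a * f u + f v) ->
  (forall u, `|f u| <= M * dot_norm dU u) ->
  exists l, forall v, f v = dU l v.
Proof.
move=> flin fbnd.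
have fD u v : f (u + v) = f u + f v by rewrite -[u]scale1r flin scale1r mul1r.
have f0 : f 0 = 0 by have := fD 0 0; rewrite addr0; lra.
have fZ a u : f (a *: u) = a * f u by rewrite -[a *: u]addr0 flin f0 addr0.
have [||||l [t [lt min]]] := @epigraph_minimizer (fun u t => - f u <= t) (- M ^+ 2 / 2).
- by exists 0, 0; rewrite f0 oppr0.
- move=> u v s t a /andP[a0 a1] us vt; rewrite fD !fZ.
  by have := ler_wpM2l a0 vt; have := @ler_wpM2l _ (1 - a) _ _ _ us; lra.
- move=> u t l k ut ul tk; apply: ler_cvg_to (_ : - f (u n) @[n --> \oo] --> - f l) tk _.
    apply: cvgN; apply: cvg_dist_le (_ : M * dot_norm dU (u n - l) @[n --> \oo] --> 0).
      move=> n; have -> : f (u n) - f l = f (u n - l).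
        by rewrite fD -scaleN1r fZ mulN1r.
      exact: fbnd.
    by rewrite -(mulr0 M); exact: cvgM (cvg_cst _) ul.
  exact: nearW.
- move=> u t ut; rewrite -sqr_dot_norm.
  have := ler_norm (f u); have := fbnd u; have := sqr_ge0 (dot_norm dU u - M).
  rewrite sqrrB; lra.
have key y : f y <= dU l y.
  have := min (l + y) _ (lexx _); rewrite fD [l + y]addrC addrK; lra.
exists l => v; apply/eqP; rewrite eq_le key /=.
by have := key (- v); rewrite -scaleN1r fZ dotZr; lra.
Qed.

End Minimisation.
End Completeness.

(** * Minty's theorem *)

Section Minty.
Context {R : realType} {U : lmodType R} (dU : {dot U for idfun}).

Lemma maximally_monotone_related (A : U -> set U) :
  maximally_monotone dU A ->
  forall x u, (forall y v, A y v -> 0 <= dU (x - y) (u - v)) -> A x u.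
Proof.
move=> [mA maxA] x u rel.
pose B y : set U := [set v | A y v \/ (y = x /\ v = u)].
apply: (maxA B); last by right.
- move=> y y' v v' [yv|[-> ->]] [yv'|[-> ->]].
  + exact: mA.
  + by rewrite -opprB -[v - u]opprB dotNl dotNr opprK rel.
  + exact: rel.
  + by rewrite subrr dot0l.
- by move=> y v; left.
Qed.

Let pr (x u : U) : 'I_2 -> U := fun i => if i == ord0 then x else u.

Let prod_dot2 w w' : prod_dot dU (n:=2) w w'
  = dU (w ord0) (w' ord0) + dU (w ord_max) (w' ord_max).
Proof.
rewrite /prod_dot !big_ord_recl big_ord0 addr0.
by rewrite (_ : lift ord0 ord0 = ord_max)//; exact: val_inj.
Qed.

(** The Fitzpatrick function of [A] is the supremum of the affine functions
    [(x, u) |-> <y, u> + <x, v> - <y, v>] over the graph of [A]; it is at least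
    [<x, u>]. If [(x, u)] minimises its sum with [(|x|^2 + |u|^2) / 2], the first
    order condition says that [(- u, - x)] is monotonically related to the graph,
    with a margin [|x + u|^2]: the pair is then in the graph, and [x + u = 0]. *)
Lemma maximally_monotone_antidiagonal (A : U -> set U) :
  complete_dot dU -> monotone_operator dU A ->
  (forall x u, (forall y v, A y v -> 0 <= dU (x - y) (u - v)) -> A x u) ->
  exists x, A x (- x).
Proof.
move=> cU mA relA.
pose C (w : 'I_2 -> U) (t : R) := forall y v, A y v ->
  dU y (w ord_max) + dU (w ord0) v - dU y v <= t.
have CA y v : A y v -> C (pr y v) (dU y v).
  move=> yv y' v' yv'; rewrite /pr /=.
  by have := mA _ _ _ _ yv yv'; rewrite !dotE; lra.
have Fitzpatrick_ge w t : C w t -> dU (w ord0) (w ord_max) <= t.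
  move=> Cwt; rewrite leNgt; apply/negP => lt_t.
  have /Cwt : A (w ord0) (w ord_max).
    apply: relA => y v /Cwt; rewrite !dotE; lra.
  lra.
have [||||w [t [Cwt min]]] :=
  @epigraph_minimizer _ _ (prod_dot dU (n:=2)) (complete_prod_dot cU) C 0.
- have [[y [v yv]]|none] := pselect (exists y v, A y v).
    by exists (pr y v), (dU y v); exact: CA.
  exists 0, 0 => y v yv; case: none; by exists y, v.
- move=> w w' s t a /andP[a0 a1] ws wt y v yv.
  have := ler_wpM2l a0 (wt y v yv).
  have := @ler_wpM2l _ (1 - a) _ _ _ (ws y v yv).
  rewrite !dotE; lra.
- move=> w t l k wt wl tk y v yv.
  have cst z : strongly_converges dU \oo (fun=> z) z.
    by rewrite /strongly_converges subrr dot_norm0; exact: cvg_cst.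
  have cv i : strongly_converges dU \oo (w ^~ i) (l i).
    exact: strongly_converges_coord wl.
  have lim : (dU y (w n ord_max) + dU (w n ord0) v - dU y v) @[n --> \oo]
      --> dU y (l ord_max) + dU (l ord0) v - dU y v.
    apply: cvgB; last exact: cvg_cst.
    apply: cvgD; first exact: (strongly_converges_dot (u := fun=> y)).
    exact: (strongly_converges_dot (v := fun=> v)).
  by apply: ler_cvg_to lim tk _; apply: nearW => n; exact: wt.
- move=> w t /Fitzpatrick_ge h; rewrite /= prod_dot2.
  have := dot_ge0 dU (w ord0 + w ord_max); rewrite !dotE.
  rewrite (dotC _ (w ord_max) (w ord0)); lra.
set x := w ord0; set u := w ord_max.
have margin y v : A y v -> dU (x + u) (x + u) <= dU (- u - y) (- x - v).
  move=> /CA /min; rewrite /= prod_dot2 /pr /= -/x -/u.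
  have := Fitzpatrick_ge _ _ Cwt; rewrite -/x -/u !dotE.
  rewrite (dotC _ u x) (dotC _ y x); lra.
have Aux : A (- u) (- x).
  by apply: relA => y v /margin h; exact: le_trans (dot_ge0 _ _) h.
have /dot_eq0/eqP : dU (x + u) (x + u) = 0.
  apply/eqP; rewrite eq_le dot_ge0 andbT.
  by have := margin _ _ Aux; rewrite !subrr dot0l.
by rewrite addr_eq0 => /eqP xu; exists x; rewrite {1}xu.
Qed.

Theorem Minty (A : U -> set U) : complete_dot dU -> maximally_monotone dU A ->
  forall x, exists y, resolvent_graph A x y.
Proof.
move=> cU maxA x.
have relA := maximally_monotone_related maxA; have mA := proj1 maxA.
have [||y yA] := @maximally_monotone_antidiagonal (fun y => [set u | A y (u + x)]) cU.
- move=> y y' v v' /= yv yv'; have := mA _ _ _ _ yv yv'.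
  by rewrite opprD addrACA subrr addr0.
- move=> y u /= rel; apply: relA => y' v yv.
  have := rel y' (v - x); rewrite /= subrK => /(_ yv).
  by rewrite opprB addrCA addrC addrAC.
by exists y; exists (- y + x) => //; rewrite addrA subrr add0r.
Qed.

End Minty.

(** * Weak limits along ultrafilters *)

Section Ultrafilters.
Context {R : realType}.

Lemma cvg_subfilter {T : Type} {V : topologicalType} (F G : set_system T)
    (f : T -> V) (l : V) : F `<=` G -> f @ F --> l -> f @ G --> l.
Proof. by move=> FG fl B /fl; exact: FG. Qed.

(** If the preimage of a neighbourhood of [l] were not in [F], some ultrafilter
    finer than [F] would contain the complement of that preimage. *)
Lemma cvg_ultra {T : Type} {V : topologicalType} (F : set_system T)
    {FF : ProperFilter F} (f : T -> V) (l : V) :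
  (forall G, UltraFilter G -> F `<=` G -> f @ G --> l) -> f @ F --> l.
Proof.
move=> fG B Bl; apply: contrapT => nFB.
pose D := ~` (f @^-1` B).
have PF : ProperFilter (within D F).
  apply: Build_ProperFilter => W0; apply: nFB.
  by have : F (~` D) := W0; rewrite /D setCK.
have [G [UG FG]] := ultraFilterLemma PF.
have sub : F `<=` G by move=> W FW; apply: FG; apply: filterS FW => t Wt _.
have GB : G (f @^-1` B) := fG G UG sub B Bl.
have GD : G D by apply: FG; exact: nearW.
have := @filter_ex _ G _ _ (filterI GB GD).
by case=> t [].
Qed.

Lemma bounded_ultra_cvg {T : Type} (G : set_system T) {UG : UltraFilter G}
    (f : T -> R) (M : R) : (forall t, `|f t| <= M) -> exists l : R, f @ G --> l.
Proof.
move=> fM; have PG := @ultra_proper _ G UG.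
have Gseg : (f @ G) `[- M, M]%classic.
  by apply: nearW => t /=; rewrite in_itv/= -ler_norml.
have [l [_ lcl]] := segment_compact _ Gseg.
exists l => B Bl; have [//|GB] := in_ultra_setVsetC (f @^-1` B) UG.
by have [y []] := lcl (~` B) B GB Bl.
Qed.

Lemma cvgr_unique {T : Type} (F : set_system T) {FF : ProperFilter F}
    (f : T -> R) (a b : R) : f @ F --> a -> f @ F --> b -> a = b.
Proof. by move=> fa fb; exact: (cvg_unique (@Rhausdorff R) fa fb). Qed.

End Ultrafilters.

Section WeakLimits.
Context {R : realType} {U : lmodType R} (dU : {dot U for idfun}).
Hypothesis cU : complete_dot dU.

Definition weak_limit (F : set_system nat) (u : nat -> U) (l : U) : Prop :=
  forall v, dU (u n) v @[n --> F] --> dU l v.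

Lemma weak_limit_strongly (F : set_system nat) {FF : Filter F} (u : nat -> U) l :
  strongly_converges dU F u l -> weak_limit F u l.
Proof.
move=> ul v.
apply: (strongly_converges_dot (v := fun=> v)) => //.
by rewrite /strongly_converges subrr dot_norm0; exact: cvg_cst.
Qed.

Lemma weak_limitD (F : set_system nat) {FF : Filter F} (u v : nat -> U) l k :
  weak_limit F u l -> weak_limit F v k -> weak_limit F (fun n => u n + v n) (l + k).
Proof.
move=> ul vk y; rewrite dotDl; under eq_fun do rewrite dotDl.
by apply: cvgD; [exact: ul|exact: vk].
Qed.

Lemma weak_limitZ (F : set_system nat) {FF : Filter F} (a : nat -> R) (b : R)
    (u : nat -> U) l :
  a @ F --> b -> weak_limit F u l -> weak_limit F (fun n => a n *: u n) (b *: l).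
Proof.
move=> ab ul y; rewrite dotZl; under eq_fun do rewrite dotZl.
by apply: cvgM => //; exact: ul.
Qed.

Lemma weak_limit_sum (F : set_system nat) {FF : Filter F} (I : Type) (r : seq I)
    (P : pred I) (u : I -> nat -> U) (l : I -> U) :
  (forall i, P i -> weak_limit F (u i) (l i)) ->
  weak_limit F (fun n => \sum_(i <- r | P i) u i n) (\sum_(i <- r | P i) l i).
Proof.
move=> ul y; rewrite dot_suml; under eq_fun do rewrite dot_suml.
by apply: cvg_sumr => i Pi; exact: ul.
Qed.

(** The limits of the [<u n, v>] along [G] form a bounded linear functional of
    [v]; its Riesz representative is the weak limit. Ultrafilters thus play the
    role of weakly convergent subsequences without any separability argument. *)
Lemma bounded_weak_limit (G : set_system nat) {UG : UltraFilter G}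
    (u : nat -> U) (M : R) :
  (forall n, dot_norm dU (u n) <= M) -> exists l, weak_limit G u l.
Proof.
move=> uM; have PG := @ultra_proper _ G UG.
have bnd v n : `|dU (u n) v| <= M * dot_norm dU v.
  apply: le_trans (CauchySchwarz_dot _ _ _) _.
  by rewrite ler_wpM2r// dot_norm_ge0.
have /choice[f fP] v : exists l : R, dU (u n) v @[n --> G] --> l.
  exact: bounded_ultra_cvg (bnd v).
have [a v w|v|l lP] := @Riesz _ _ _ cU f M.
- apply: cvgr_unique (fP _) _; under eq_fun do rewrite dotDr dotZr.
  by apply: cvgD (fP w); apply: cvgM (fP v); exact: cvg_cst.
- apply: (@ler_cvg_to _ _ PG _ _ (fun=> M * dot_norm dU v) _ _ (cvg_norm (fP v))).
    exact: cvg_cst.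
  by apply: nearW => n; exact: bnd.
- by exists l => v; rewrite -lP.
Qed.

(** Two weak limits [l] and [k] of [u] in [D] coincide, because
    [2 <u n, l - k> = |u n - k|^2 - |u n - l|^2 + |l|^2 - |k|^2] converges. *)
Lemma Opial (u : nat -> U) (M : R) (D : set U) :
  (forall n, dot_norm dU (u n) <= M) ->
  (forall p, D p -> cvgn (fun n => dot_norm dU (u n - p))) ->
  (forall G, UltraFilter G -> \oo `<=` G -> forall l, weak_limit G u l -> D l) ->
  exists l, D l /\ weakly_converges dU u l.
Proof.
move=> uM uD DG.
have [G [UG ooG]] := @ultraFilterLemma _ \oo _.
have [l lG] := bounded_weak_limit uM.
have Dl := DG _ UG ooG _ lG.
exists l; split=> // v; apply: cvg_ultra => H UH ooH.
have [k kH] := bounded_weak_limit uM.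
suff -> : l = k by exact: kH.
have Dk := DG _ UH ooH _ kH.
have [c cP] : exists c : R, dU (u n) (l - k) @[n --> \oo] --> c.
  have /cvg_ex[/= a ua] := uD _ Dl; have /cvg_ex[/= b ub] := uD _ Dk.
  exists ((b ^+ 2 - a ^+ 2 + dU l l - dU k k) / 2).
  rewrite (_ : (fun n => _) = fun n => (dot_norm dU (u n - k) ^+ 2
    - dot_norm dU (u n - l) ^+ 2 + dU l l - dU k k) / 2); last first.
    by apply/funext => n; rewrite !sqr_dot_normB !dotE !sqr_dot_norm; field.
  apply: cvgM; last exact: cvg_cst.
  apply: cvgB; last exact: cvg_cst.
  apply: cvgD; last exact: cvg_cst.
  by apply: cvgB; exact: cvgM.
have PG := @ultra_proper _ _ UG; have PH := @ultra_proper _ _ UH.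
have lc := cvgr_unique (lG (l - k)) (cvg_subfilter ooG cP).
have kc := cvgr_unique (kH (l - k)) (cvg_subfilter ooH cP).
apply/eqP; rewrite -subr_eq0; apply/eqP/(@dot_eq0 _ _ dU).
by rewrite dotBl lc kc subrr.
Qed.

End WeakLimits.

(** * Sequences of reals *)

Section QuasiFejer.
Context {R : realType}.

Lemma cvgn_bounded (f : nat -> R) : cvgn f -> exists M, forall n, `|f n| <= M.
Proof.
move=> /cvg_seq_bounded[M [_ hM]]; exists (M + 1) => n.
by apply: hM; rewrite ?ltrDl.
Qed.

(** With [P n] the product of the first [n] factors, [a n / P n] is nonincreasing,
    while [P n] is nondecreasing and at most [exp (\sum_n (L n - 1))]. *)
Lemma quasi_Fejer_cvg (a L : nat -> R) :
  (forall n, 0 <= a n) -> (forall n, 1 <= L n) ->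
  (forall n, a n.+1 <= L n * a n) ->
  (\sum_(0 <= n <oo) (L n - 1)%:E < +oo)%E -> cvgn a.
Proof.
move=> a0 L1 aL sumL.
pose P n := \prod_(0 <= k < n) L k.
have PS n : P n.+1 = P n * L n by rewrite /P big_nat_recr.
have P1 n : 1 <= P n.
  elim: n => [|n IH]; first by rewrite /P big_geq.
  by rewrite PS; have := L1 n; nra.
have P0 n : 0 < P n by apply: lt_le_trans (P1 n).
have eps0 n : 0 <= L n - 1 by rewrite subr_ge0.
have cS := nnseries_is_cvg eps0 sumL.
have Sle n : series (fun n => L n - 1) n <= limn (series (fun n => L n - 1)).
  apply: nondecreasing_cvgn_le => //; apply: nondecreasing_series => k _ _.
  exact: eps0.
have Pexp n : P n <= expR (series (fun n => L n - 1) n).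
  elim: n => [|n IH]; first by rewrite /P /series /= !big_geq// expR0.
  rewrite PS seriesSr expRD; apply: ler_pM => //; first exact: ltW.
    exact: le_trans (L1 n).
  by have := expR_ge1Dx (L n - 1); rewrite addrC subrK.
have cP : cvgn P.
  apply: nondecreasing_is_cvgn.
    by apply/nondecreasing_seqP => n; rewrite PS ler_peMr// ltW.
  exists (expR (limn (series (fun n => L n - 1)))) => _ [n _ <-].
  by apply: le_trans (Pexp n) _; rewrite ler_expR.
have cQ : cvgn (fun n => a n / P n).
  apply: nonincreasing_is_cvgn.
    apply/nonincreasing_seqP => n.
    by rewrite ler_pdivrMr// PS mulrA divfK ?gt_eqF// mulrC.
  by exists 0 => _ [n _ <-]; rewrite divr_ge0// ltW.
have -> : a = fun n => a n / P n * P n.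
  by apply/funext => n; rewrite divfK// gt_eqF.
exact: is_cvgM.
Qed.

End QuasiFejer.

(** * Graphs and onto decompositions of the Laplacian *)

Section Graphs.
Context {N : nat} (E : rel 'I_N).

Lemma graph_connected_ind (r : 'I_N -> 'I_N -> Prop) :
  (forall i, r i i) -> (forall i j, r i j -> r j i) ->
  (forall i j k, r i j -> r j k -> r i k) ->
  graph_connected E -> (forall i j, E i j -> r i j) -> forall i j, r i j.
Proof.
move=> rr rs rt Econn Er i j; have /connectP[s] := Econn i j.
elim: s i => [|k s IH] i /=; first by move=> _ ->.
move=> /andP[ik ks] jE; apply: (rt _ k); last exact: IH.
by case/orP: ik => /Er // /rs.
Qed.

(** If [i] had no neighbour, being equal to [i] would be invariant along edges, hence
    on the whole connected graph, and [i] would be the only node. *)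
Lemma degree_gt0 (i : 'I_N) : (2 <= N)%N -> graph_connected E -> (0 < degree E i)%N.
Proof.
move=> N2 Econn; rewrite lt0n cards_eq0; apply/negP => /eqP/setP no_edge.
have isolated h k : E h k -> (h == i) = (k == i).
  move=> hk; have [hi|hi] := eqVneq h i.
    by have := no_edge k; rewrite !inE -hi hk.
  have [ki|//] := eqVneq k i.
  by have := no_edge h; rewrite !inE -ki hk orbT.
have all_i j : j = i.
  apply/eqP; rewrite -[_ == _]
    (graph_connected_ind (r := fun h k => (h == i) = (k == i)) _ _ _ Econn isolated i j) ?eqxx//.
  by move=> h k l -> ->.
have := ltn_trans (ltnSn 0) N2 => N0.
have := congr1 val (etrans (all_i (Ordinal N0)) (esym (all_i (Ordinal N2)))).
by [].
Qed.

Hypothesis Elt : forall i j, E i j -> (i < j)%N.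

Let E_asym i j : E i j -> E j i = false.
Proof. by move=> /Elt ij; apply/negP => /Elt; rewrite ltnNge ltnW. Qed.

(** No two nodes are joined in both directions, so that each neighbouring pair comes
    from a single edge. *)
Lemma sum_neighbours (V : zmodType) (f : 'I_N -> 'I_N -> V) :
  \sum_i \sum_(j | E i j || E j i) f i j
  = \sum_i \sum_(h | E h i) (f h i + f i h).
Proof.
transitivity (\sum_i \sum_(j | E i j) f i j + \sum_i \sum_(j | E j i) f i j).
  rewrite -big_split /=; apply: eq_bigr => i _.
  rewrite big_mkcond [in RHS]big_mkcond [X in _ = _ + X]big_mkcond -big_split /=.
  apply: eq_bigr => j _; have [ij|_] := boolP (E i j).
    by rewrite (E_asym ij) addr0.
  by rewrite add0r.
have -> : \sum_i \sum_(j | E i j) f i j = \sum_i \sum_(h | E h i) f h i.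
  exact: exchange_big_dep.
by rewrite -big_split /=; apply: eq_bigr => i _; rewrite -big_split.
Qed.

Lemma sum_mul_degree (V : zmodType) (q : 'I_N -> V) :
  \sum_i q i *+ degree E i = \sum_i \sum_(h | E h i) (q h + q i).
Proof.
rewrite -(sum_neighbours (fun i _ => q i)); apply: eq_bigr => i _.
by rewrite sumr_const /degree cardsE.
Qed.

Lemma sum_predecessors_const (V : zmodType) (c : V) i :
  \sum_(h | E h i) c = c *+ in_degree E i.
Proof. by rewrite sumr_const /in_degree cardsE. Qed.

Lemma sum_degree_indegree {R : pzRingType} :
  \sum_i ((degree E i)%:R - 2 * (in_degree E i)%:R : R) = 0.
Proof.
rewrite sumrB sum_mul_degree; apply/eqP; rewrite subr_eq0; apply/eqP.
by apply: eq_bigr => i _; rewrite sum_predecessors_const mulr_natr mulr2n.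
Qed.

End Graphs.

Section TensorId.
Context {R : realType} {X : lmodType R} {m n : nat} (S : 'M[R]_(m, n)).
Implicit Types x y : 'I_n -> X.

Lemma tensor_idD x y : tensor_id S (x + y) = tensor_id S x + tensor_id S y.
Proof.
apply/funext => i; transitivity (\sum_j (S i j *: x j + S i j *: y j)).
  by apply: eq_bigr => j _; rewrite -scalerDr.
by rewrite big_split.
Qed.

Lemma tensor_idZ a x : tensor_id S (a *: x) = a *: tensor_id S x.
Proof.
apply/funext => i; transitivity (\sum_j a *: (S i j *: x j)).
  by apply: eq_bigr => j _; rewrite !scalerA mulrC -scalerA.
by rewrite -scaler_sumr.
Qed.

Lemma tensor_idB x y : tensor_id S (x - y) = tensor_id S x - tensor_id S y.
Proof. by rewrite -scaleN1r tensor_idD tensor_idZ scaleN1r. Qed.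

Lemma tensor_id0 : tensor_id S (0 : 'I_n -> X) = 0.
Proof. by rewrite -(scale0r 0) tensor_idZ scale0r. Qed.

End TensorId.

Section Laplacian.
Context {R : realType} {X : lmodType R} (dot : {dot X for idfun}).
Context {N p : nat} (E : rel 'I_N) (S : 'M[R]_(N, p)).
Hypotheses (Elt : forall i j, E i j -> (i < j)%N) (Econn : graph_connected E).
Hypothesis hS : onto_decomposition (laplacian E) S.

Local Notation dotp := (prod_dot dot (n:=p) : {dot ('I_p -> X) for idfun}).
Local Notation dotN := (prod_dot dot (n:=N) : {dot ('I_N -> X) for idfun}).

(** As [L = S S^*], this quadratic form is also [|S^* z|^2], which by connectedness
    determines the kernel of [S^*]. *)
Lemma dot_laplacian (z : 'I_N -> X) :
  dotN z (tensor_id (laplacian E) z)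
  = \sum_i \sum_(h | E h i) dot (z h - z i) (z h - z i).
Proof.
have Eirr i : E i i = false by apply/negP => /Elt; rewrite ltnn.
transitivity (\sum_i dot (z i) (z i) *+ degree E i
    - \sum_i \sum_(j | E i j || E j i) dot (z i) (z j)).
  rewrite -sumrB; apply: eq_bigr => i _.
  rewrite /tensor_id dot_sumr (bigD1 i) //= mxE eqxx dotZr mulr_natl; congr (_ + _).
  rewrite -sumrN [RHS]big_mkcond /= [in RHS](bigD1 i) //= Eirr add0r.
  apply: eq_bigr => j ji; rewrite mxE eq_sym (negbTE ji) dotZr.
  by case: ifP => _; rewrite ?mulN1r ?mul0r.
rewrite (sum_neighbours Elt) (sum_mul_degree Elt) -sumrB.
apply: eq_bigr => i _; rewrite -sumrB; apply: eq_bigr => h _.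
by rewrite !dotE (dotC _ (z i) (z h)); ring.
Qed.

Lemma dot_adjoint_tensor_id (z : 'I_N -> X) :
  dotp (tensor_id S^T z) (tensor_id S^T z)
  = \sum_i \sum_(h | E h i) dot (z h - z i) (z h - z i).
Proof.
rewrite -dot_laplacian (proj1 hS) -tensor_id_mul.
by rewrite [LHS](is_adjoint_tensor_id dot S^T) trmxK.
Qed.

Lemma adjoint_tensor_id_const (u : X) : tensor_id S^T (fun=> u) = 0.
Proof.
apply: (@dot_eq0 _ _ dotp); rewrite [LHS]dot_adjoint_tensor_id.
by rewrite big1// => i _; rewrite big1// => h _; rewrite subrr dot0l.
Qed.

Lemma sum_tensor_id (x : 'I_p -> X) : \sum_i tensor_id S x i = 0.
Proof.
apply: (@dot_inj _ _ dot) => u; rewrite dot0l dot_suml.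
transitivity (dotN (tensor_id S x) (fun=> u)); first by [].
by rewrite [LHS]is_adjoint_tensor_id adjoint_tensor_id_const dot0r.
Qed.

Lemma adjoint_tensor_id_eq0 (z : 'I_N -> X) :
  tensor_id S^T z = 0 -> forall i j, z i = z j.
Proof.
move=> Sz0; apply: graph_connected_ind (Econn) _ => //.
- by move=> i j k -> ->.
move=> h i hi; apply/eqP; rewrite -subr_eq0; apply/eqP/(@dot_eq0 _ _ dot).
have := dot_adjoint_tensor_id z; rewrite Sz0 dot0l => /esym/eqP.
rewrite psumr_eq0 => [/allP/(_ i)|k _]; last by apply: sumr_ge0 => l _; exact: dot_ge0.
rewrite mem_index_enum psumr_eq0 => [/(_ isT)/allP/(_ h)|l _]; last exact: dot_ge0.
by rewrite mem_index_enum hi => /(_ isT)/eqP.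
Qed.

(** A left kernel vector [y] of [S^* S] satisfies [|y S^*|^2 = 0], and the
    surjectivity of [S^*] turns [y S^* = 0] into [y = 0]. *)
Lemma gram_unitmx : S^T *m S \in unitmx.
Proof.
have [_ onto] := hS.
have /choice[Y SY] j : exists y : 'cV[R]_N, S^T *m y = col j 1%:M by exact: onto.
have SY1 : S^T *m \matrix_(i, j) Y j i ord0 = 1%:M.
  apply/matrixP => i j; have := congr1 (fun v : 'cV_p => v i ord0) (SY j).
  rewrite !mxE => <-; by apply: eq_bigr => k _; rewrite !mxE.
rewrite -row_free_unit -kermx_eq0; apply/eqP/row_matrixP => i.
rewrite row0; set y := row i _.
have yK : y *m (S^T *m S) = 0 by rewrite /y -row_mul mulmx_ker row0.
have sqr0 (v : 'rV[R]_N) : v *m v^T = 0 -> v = 0.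
  move=> /(congr1 (fun M : 'M[R]_1 => M ord0 ord0)); rewrite !mxE => /eqP.
  rewrite psumr_eq0 => [/allP v0|j _]; last by rewrite mxE -expr2 sqr_ge0.
  apply/rowP => j; rewrite [RHS]mxE; apply/eqP.
  by have := v0 j (mem_index_enum _); rewrite mxE -expr2 sqrf_eq0.
have yS0 : y *m S^T = 0.
  by apply: sqr0; rewrite trmx_mul trmxK mulmxA -(mulmxA y) yK mul0mx.
by rewrite -[LHS]mulmx1 -SY1 mulmxA yS0 mul0mx.
Qed.

Local Notation Sdag := (pseudo_inverse dotp dotN (tensor_id S)).

Lemma pseudo_inverseE : Sdag = tensor_id (invmx (S^T *m S) *m S^T).
Proof. exact: pseudo_inverse_tensor_id gram_unitmx. Qed.

Lemma pseudo_inverseK (x : 'I_p -> X) : Sdag (tensor_id S x) = x.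
Proof. by rewrite pseudo_inverseE tensor_id_mul -mulmxA mulVmx ?gram_unitmx// tensor_id1. Qed.

(** This is why centering a vector of [X^N] does not change its image by [S^+]. *)
Lemma pseudo_inverse_const (u : X) : Sdag (fun=> u) = 0.
Proof. by rewrite pseudo_inverseE -tensor_id_mul adjoint_tensor_id_const tensor_id0. Qed.

(** The difference [a - S (S^+ a)] is in the kernel of the adjoint, hence constant
    by connectedness, and its entries add up to zero. *)
Lemma tensor_id_pseudo_inverse (a : 'I_N -> X) : \sum_i a i = 0 -> tensor_id S (Sdag a) = a.
Proof.
move=> suma; apply/esym/eqP; rewrite -subr_eq0; apply/eqP.
set v := a - _.
have vcst : forall i j, v i = v j.
  apply: adjoint_tensor_id_eq0.
  rewrite /v tensor_idB pseudo_inverseE !tensor_id_mul !mulmxA mulmxV ?gram_unitmx//.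
  by rewrite mul1mx subrr.
have sumv : \sum_i v i = 0.
  by rewrite /v sumrB suma sum_tensor_id subrr.
apply/funext => i; apply/eqP; move: sumv.
rewrite (eq_bigr (fun=> v i)) => [|j _]; last exact: vcst.
rewrite sumr_const card_ord -scaler_nat => /eqP; rewrite scaler_eq0 pnatr_eq0.
by case/orP => // /eqP N0; have := ltn_ord i; rewrite {2}N0.
Qed.

End Laplacian.

(** * Resolvents *)

Section Resolvent.
Context {R : realType} {X : lmodType R} (dot : {dot X for idfun}).
Hypothesis cX : complete_dot dot.

Lemma maximally_monotone_scale (A : X -> set X) (c : R) : 0 < c ->
  maximally_monotone dot A -> maximally_monotone dot (scale_operator c A).
Proof.
move=> c0 maxA; split.
  move=> x y _ _ [u xu <-] [v yv <-]; rewrite -scalerBr dotZr.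
  by rewrite mulr_ge0 ?(ltW c0)//; exact: (proj1 maxA).
move=> B mB AB x u Bxu; exists (c^-1 *: u); last by rewrite scalerA divff ?gt_eqF// scale1r.
apply: (maximally_monotone_related maxA) => y v yv.
rewrite -(pmulr_rge0 _ c0) -dotZr scalerBr scalerA divff ?gt_eqF// scale1r.
by apply: mB => //; apply: AB; exists v.
Qed.

Lemma resolvent_scaleP (A : X -> set X) (c : R) (x y : X) : 0 < c ->
  maximally_monotone dot A ->
  y = resolvent (scale_operator c A) x <-> A y (c^-1 *: (x - y)).
Proof.
move=> c0 maxA; have maxcA := maximally_monotone_scale c0 maxA.
have rP : resolvent_graph (scale_operator c A) x (resolvent (scale_operator c A) x).
  by apply: xgetPex; exact: (Minty cX maxcA).
split=> [->|yx].
  move: rP; move: (resolvent _ _) => r [_ [u ru <-] ->].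
  by rewrite addrC addKr scalerA mulVf ?gt_eqF// scale1r.
apply: (resolvent_graph_unique (proj1 maxcA) _ rP).
exists (x - y); last by rewrite addrC subrK.
by exists (c^-1 *: (x - y)); rewrite // scalerA divff ?gt_eqF// scale1r.
Qed.

(** If the pair of index [i] were not in the graph of [A i], maximality would give
    an element of that graph against which the [i]-th term is negative; the pairs
    that are in their graphs contribute zero terms. *)
Lemma product_related (n : nat) (A : 'I_n -> X -> set X) (x v : 'I_n -> X) :
  (forall i, maximally_monotone dot (A i)) ->
  (forall y u, (forall i, A i (y i) (u i)) ->
     0 <= \sum_i dot (x i - y i) (v i - u i)) ->
  forall i, A i (x i) (v i).
Proof.
move=> maxA rel i.
have /choice[q qP] j : exists q : X * X, A j q.1 q.2 /\
    (if `[< A j (x j) (v j) >] then dot (x j - q.1) (v j - q.2) <= 0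
     else dot (x j - q.1) (v j - q.2) < 0).
  case: asboolP => [Aj|nAj].
    by exists (x j, v j); rewrite /= subrr dot0l.
  apply: contrapT => /forallNP nq; apply: nAj.
  apply: (maximally_monotone_related (maxA j)) => y u yu.
  by rewrite leNgt; apply/negP => lt0; exact: (nq (y, u)).
have /= := rel (fun j => (q j).1) (fun j => (q j).2) (fun j => proj1 (qP j)).
rewrite leNgt => /negP sum0; apply: contrapT => nAi; apply: sum0.
rewrite (bigD1 i) //= -[ltRHS]addr0 ltr_leD//.
  by have := proj2 (qP i); case: asboolP.
apply: sumr_le0 => j _; have := proj2 (qP j).
by case: asboolP => // _ /ltW.
Qed.

End Resolvent.

(** * Estimates for the graph-based operator *)

Section OperatorNorm.
Context {R : realType} {X : lmodType R} (dot : {dot X for idfun}) {m n : nat}.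
Variable B : 'M[R]_(m, n).

Local Notation dotm := (prod_dot dot (n:=m) : {dot ('I_m -> X) for idfun}).
Local Notation dotn := (prod_dot dot (n:=n) : {dot ('I_n -> X) for idfun}).

(** With [y] the [i]-th entry, [|y|^2 = <(B_ij y)_j, x>], to which the Cauchy-Schwarz
    inequality of the power of [X] applies. *)
Lemma dot_norm_tensor_id_row (x : 'I_n -> X) i :
  dot_norm dot (tensor_id B x i) <= Num.sqrt (\sum_j B i j ^+ 2) * dot_norm dotn x.
Proof.
set y := tensor_id B x i; set s := Num.sqrt _.
have [y0|y0] := eqVneq (dot_norm dot y) 0.
  by rewrite y0 mulr_ge0 ?sqrtr_ge0 ?dot_norm_ge0.
have ypos : 0 < dot_norm dot y by rewrite lt_neqAle eq_sym y0 dot_norm_ge0.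
have yE : dot y y = dotn (fun j => B i j *: y) x.
  rewrite {2}/y dot_sumr; apply: eq_bigr => j _.
  by rewrite dotZr dotZl.
have normE : dot_norm dotn (fun j => B i j *: y) = s * dot_norm dot y.
  rewrite /dot_norm /s -sqrtrM ?sumr_ge0// => [|j _]; last exact: sqr_ge0.
  rewrite mulr_suml; congr Num.sqrt; apply: eq_bigr => j _.
  by rewrite dotZl dotZr mulrA -expr2.
have := dot_le_norm dotn (fun j => B i j *: y) x.
rewrite normE -[X in X <= _]yE -sqr_dot_norm expr2 mulrAC ler_pM2r//.
Qed.

Lemma dot_norm_tensor_id_le :
  exists C, forall x, dot_norm dotm (tensor_id B x) <= C * dot_norm dotn x.
Proof.
exists (\sum_i Num.sqrt (\sum_j B i j ^+ 2)) => x.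
apply: le_trans (prod_dot_norm_le _ _) _; rewrite mulr_suml.
by apply: ler_sum => i _; exact: dot_norm_tensor_id_row.
Qed.

Let tensor_id_bounded :
  has_ubound [set dot_norm dotm (tensor_id B u) | u in [set u | dot_norm dotn u <= 1]].
Proof.
have [C hC] := dot_norm_tensor_id_le.
exists `|C| => _ [u u1 <-]; apply: le_trans (hC u) _.
apply: le_trans (ler_wpM2r (dot_norm_ge0 _ _) (ler_norm C)) _.
by rewrite ler_piMr.
Qed.

Lemma operator_norm_ge0 : 0 <= operator_norm dotn dotm (tensor_id B).
Proof.
apply: (@le_trans _ _ (dot_norm dotm (tensor_id B 0))); first exact: dot_norm_ge0.
by apply: ub_le_sup => //; exists 0 => //=; rewrite dot_norm0.
Qed.

Lemma operator_norm_tensor_id (x : 'I_n -> X) :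
  dot_norm dotm (tensor_id B x)
  <= operator_norm dotn dotm (tensor_id B) * dot_norm dotn x.
Proof.
have [x0|x0] := eqVneq (dot_norm dotn x) 0.
  by rewrite x0 mulr0 (dot_norm_eq0 x0) tensor_id0 dot_norm0.
have xpos : 0 < dot_norm dotn x by rewrite lt_neqAle eq_sym x0 dot_norm_ge0.
rewrite -ler_pdivrMr// mulrC -[_^-1]ger0_norm ?invr_ge0 ?dot_norm_ge0//.
rewrite -dot_normZ -tensor_idZ; apply: ub_le_sup => //.
exists ((dot_norm dotn x)^-1 *: x) => //=.
by rewrite dot_normZ ger0_norm ?invr_ge0 ?dot_norm_ge0// mulVf.
Qed.

End OperatorNorm.

Section Estimates.
Context {R : realType} {X : lmodType R} (dot : {dot X for idfun}).
Context {N p : nat} (E E' : rel 'I_N) (S : 'M[R]_(N, p)).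
Hypotheses (Elt : forall i j, E i j -> (i < j)%N)
  (deg_gt0 : forall i, (0 < degree E i)%N)
  (E'E : forall i j, E' i j -> E i j) (E'conn : graph_connected E')
  (hS : onto_decomposition (laplacian E') S).

Local Notation dotp := (prod_dot dot (n:=p) : {dot ('I_p -> X) for idfun}).
Local Notation dotN := (prod_dot dot (n:=N) : {dot ('I_N -> X) for idfun}).
Local Notation d i := ((degree E i)%:R : R).
Local Notation dplus i := ((in_degree E i)%:R : R).
Local Notation Sdag := (pseudo_inverse dotp dotN (tensor_id S)).

Let E'lt i j : E' i j -> (i < j)%N.
Proof. by move=> /E'E /Elt. Qed.

Let d_gt0 i : 0 < d i.
Proof. by rewrite ltr0n. Qed.

(** The vector [gamma *: u] with [u \in A i (z i)] prescribed by the recursion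
    that defines [z] from [x]. *)
Definition dr_residual (x : 'I_p -> X) (z : 'I_N -> X) (i : 'I_N) : X :=
  2 *: (\sum_(h | E h i) z h) + tensor_id S x i - d i *: z i.

(** The recursion without its resolvents: in this form it is linear in the data,
    so that the residuals of two solutions can be subtracted. *)
Definition dr_inclusion (A : 'I_N -> X -> set X) (gamma : R) (x : 'I_p -> X)
    (z : 'I_N -> X) : Prop :=
  forall i, A i (z i) (gamma^-1 *: dr_residual x z i).

(** The uncentered error vector of the relocation. When all the [z i] equal [u],
    its entries add up to zero, because each edge contributes one to the in-degrees
    and two to the degrees; it then satisfies [S (S^+ (balance z)) = balance z]. *)
Definition balance (z : 'I_N -> X) : 'I_N -> X :=
  fun i => (d i - 2 * dplus i) *: z i.

Lemma dr_residualB x x' z z' i :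
  dr_residual (x - x') (z - z') i = dr_residual x z i - dr_residual x' z' i.
Proof.
rewrite /dr_residual tensor_idB sumrB.
(* pairing with an arbitrary vector turns an identity of vectors into one of reals *)
apply: (@dot_inj _ _ dot) => v; rewrite -[(_ - _) i]/(_ i - _ i) !dotE; ring.
Qed.

Lemma dr_inclusionP (A : 'I_N -> X -> set X) (gamma : R) x z :
  complete_dot dot -> (forall i, maximally_monotone dot (A i)) -> 0 < gamma ->
  (forall i, z i = dr_step E S A gamma x z i) <-> dr_inclusion A gamma x z.
Proof.
move=> cX maxA g0.
have argE i : (gamma / d i)^-1 *: ((2 / d i) *: (\sum_(h | E h i) z h)
    + (d i)^-1 *: (\sum_j S i j *: x j) - z i) = gamma^-1 *: dr_residual x z i.
  have dn0 : d i != 0 by rewrite gt_eqF.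
  rewrite invf_div scalerBr scalerDr !scalerA /dr_residual scalerBr scalerDr !scalerA.
  congr (_ *: _ + _ *: _ - _ *: _).
  - by field; rewrite dn0 gt_eqF.
  - by field; rewrite dn0 gt_eqF.
  - by rewrite mulrC.
split=> zP i.
  rewrite -argE; apply/(resolvent_scaleP cX _ _ _ (maxA i)) => //.
  exact: divr_gt0.
apply/(resolvent_scaleP cX _ _ _ (maxA i)); first exact: divr_gt0.
by rewrite argE.
Qed.

Lemma dr_shadow_unique (A : 'I_N -> X -> set X) (gamma : R) x z :
  (forall i, z i = dr_step E S A gamma x z i) -> dr_shadow E S A gamma x = z.
Proof.
move=> zP; apply/funext => i.
have [n] := ubnP (i : nat); elim: n => // n IH in i *.
rewrite ltnS => lein; rewrite dr_shadowE// zP /dr_step.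
congr (resolvent _ (_ *: _ + _)); apply: eq_bigr => h /Elt hi.
by apply: IH; exact: leq_trans hi lein.
Qed.

(** The energy identity behind both the contraction estimate and the passage to
    the weak limit. Each diagonal term [d i |z i|^2] is shared among the edges at
    [i], where it completes the squares [|z h - z i|^2]. *)
Lemma dot_dr_residual x z : \sum_i dot (z i) (dr_residual x z i)
  = dotp (tensor_id S^T z) x
    - \sum_i \sum_(h | E h i) dot (z h - z i) (z h - z i).
Proof.
have -> : dotp (tensor_id S^T z) x = \sum_i dot (z i) (tensor_id S x i).
  transitivity (dotN z (tensor_id S x)); last by [].
  by rewrite [LHS](is_adjoint_tensor_id dot S^T) trmxK.
apply/eqP; rewrite eq_sym subr_eq eq_sym; apply/eqP.
have -> : \sum_i \sum_(h | E h i) dot (z h - z i) (z h - z i)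
    = \sum_i (d i * dot (z i) (z i) - 2 * \sum_(h | E h i) dot (z i) (z h)).
  transitivity (\sum_i dot (z i) (z i) *+ degree E i
      - \sum_i 2 * \sum_(h | E h i) dot (z i) (z h)); last first.
    by rewrite -sumrB; apply: eq_bigr => i _; rewrite [d i * _]mulr_natl.
  rewrite (sum_mul_degree Elt) -sumrB; apply: eq_bigr => i _; rewrite mulr_sumr -sumrB.
  by apply: eq_bigr => h _; rewrite !dotE (dotC _ (z i) (z h)); ring.
rewrite -big_split /=; apply: eq_bigr => i _.
rewrite /dr_residual !dotE dot_sumr; ring.
Qed.

Lemma sum_edges_mono z :
  dotp (tensor_id S^T z) (tensor_id S^T z)
  <= \sum_i \sum_(h | E h i) dot (z h - z i) (z h - z i).
Proof.
rewrite (dot_adjoint_tensor_id dot E'lt hS).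
apply: ler_sum => i _; rewrite big_mkcond [leRHS]big_mkcond /=.
apply: ler_sum => h _; case: ifP => [/E'E ->//|_].
by case: ifP => // _; exact: dot_ge0.
Qed.

Lemma balance_sum0 u : \sum_i balance (fun=> u) i = 0.
Proof. by rewrite /balance -scaler_suml sum_degree_indegree// scale0r. Qed.

(** A zero [u] of the sum, certified by [a i] in [A i u] with zero sum, yields a
    fixed point for every [gamma]. That this point is affine in [gamma] is what
    allows the relocation to follow it. *)
Lemma dr_inclusion_const (A : 'I_N -> X -> set X) (gamma : R) u (a : 'I_N -> X) :
  0 < gamma -> (forall i, A i u (a i)) -> \sum_i a i = 0 ->
  dr_inclusion A gamma (Sdag (balance (fun=> u)) + gamma *: Sdag a) (fun=> u).
Proof.
move=> g0 Aa suma i; rewrite /dr_residual tensor_idD tensor_idZ.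
rewrite (tensor_id_pseudo_inverse dot E'lt E'conn hS (balance_sum0 u)).
rewrite (tensor_id_pseudo_inverse dot E'lt E'conn hS suma) sum_predecessors_const.
rewrite [X in _ *: X](_ : _ = gamma *: a i); last first.
  rewrite -[u *+ _]scaler_nat scalerA /=.
  rewrite [_ + (_ + _)]addrA -scalerDl addrAC -scalerBl.
  by rewrite (_ : _ + _ - _ = 0) ?scale0r ?add0r//; ring.
by rewrite scalerA mulVf ?gt_eqF// scale1r.
Qed.

Lemma dr_inclusion_const_inv (A : 'I_N -> X -> set X) (gamma : R) u x :
  0 < gamma -> dr_inclusion A gamma x (fun=> u) ->
  exists a, [/\ forall i, A i u (a i), \sum_i a i = 0
    & x = Sdag (balance (fun=> u)) + gamma *: Sdag a].
Proof.
move=> g0 Ax; exists (fun i => gamma^-1 *: dr_residual x (fun=> u) i).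
have resE i : dr_residual x (fun=> u) i = tensor_id S x i - balance (fun=> u) i.
  rewrite /dr_residual /balance sum_predecessors_const -[u *+ _]scaler_nat scalerA.
  by rewrite scalerBl opprB addrCA addrA.
have sumres : \sum_i dr_residual x (fun=> u) i = 0.
  rewrite (eq_bigr _ (fun i _ => resE i)) sumrB (sum_tensor_id dot E'lt hS).
  by rewrite balance_sum0 subrr.
split=> //; first by rewrite -scaler_sumr sumres scaler0.
have -> : Sdag (fun i => gamma^-1 *: dr_residual x (fun=> u) i)
    = gamma^-1 *: (x - Sdag (balance (fun=> u))).
  rewrite -{2}[x](pseudo_inverseK dot hS) !(pseudo_inverseE dot hS) -tensor_idB -tensor_idZ.
  by congr tensor_id; apply/funext => i; rewrite resE.
by rewrite scalerA divff ?gt_eqF// scale1r addrC subrK.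
Qed.

Section TwoPoints.
Variables (A : 'I_N -> X -> set X) (gamma : R) (x x' : 'I_p -> X) (z z' : 'I_N -> X).
Hypotheses (mA : forall i, monotone_operator dot (A i)) (gamma0 : 0 < gamma)
  (xz : dr_inclusion A gamma x z) (xz' : dr_inclusion A gamma x' z').

Let residual_monotone i : 0 <= dot ((z - z') i) (dr_residual (x - x') (z - z') i).
Proof.
have := mA (xz i) (xz' i); rewrite -scalerBr dotZr -dr_residualB.
by rewrite pmulr_rge0// invr_gt0.
Qed.

(** In the energy identity for the difference of the two solutions, the left-hand
    side is nonnegative by monotonicity, and restricting the sum of squares to the
    edges of the subgraph leaves [|S^* (z - z')|^2]. *)
Lemma adjoint_cocoercive :
  dotp (tensor_id S^T (z - z')) (tensor_id S^T (z - z'))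
  <= dotp (tensor_id S^T (z - z')) (x - x').
Proof.
apply: le_trans (sum_edges_mono _) _; rewrite -subr_ge0 -dot_dr_residual.
by apply: sumr_ge0 => i _.
Qed.

Lemma dr_averaged (theta : R) : 0 <= theta ->
  dot_norm dotp (x - x' - theta *: tensor_id S^T (z - z')) ^+ 2
  <= dot_norm dotp (x - x') ^+ 2
     - theta * (2 - theta) * dot_norm dotp (tensor_id S^T (z - z')) ^+ 2.
Proof.
move=> t0; have := ler_wpM2l t0 adjoint_cocoercive.
move: (x - x') (tensor_id S^T _) => y s.
rewrite sqr_dot_normB !sqr_dot_norm !dotE (dotC _ y s); lra.
Qed.

(** Monotonicity makes the resolvent at [i] nonexpansive; the bounds then propagate
    along the edges by the recursion that defines [K_const]. *)
Lemma shadow_lipschitz i :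
  dot_norm dot (z i - z' i) <= K_const E S i / d i * dot_norm dotp (x - x').
Proof.
have [n] := ubnP (i : nat); elim: n => // n IH in i *.
rewrite ltnS => lein.
set D := z i - z' i.
set b := 2 *: (\sum_(h | E h i) (z h - z' h)) + tensor_id S (x - x') i.
have dD : d i * dot_norm dot D <= dot_norm dot b.
  have [D0|D0] := eqVneq (dot_norm dot D) 0.
    by rewrite D0 mulr0 dot_norm_ge0.
  have Dpos : 0 < dot_norm dot D by rewrite lt_neqAle eq_sym D0 dot_norm_ge0.
  have := residual_monotone i.
  rewrite -[dr_residual _ _ _]/(b - d i *: D) -[(z - z') i]/D dotBr dotZr subr_ge0.
  move=> h; have := le_trans h (dot_le_norm _ _ _).
  by rewrite -sqr_dot_norm expr2 mulrCA ler_pM2l.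
rewrite mulrAC ler_pdivlMr// mulrC; apply: le_trans dD _.
rewrite K_constE// mulrDl; apply: le_trans (dot_normD _ _ _) _.
apply: lerD; last exact: dot_norm_tensor_id_row.
rewrite dot_normZ ger0_norm// -mulrA ler_wpM2l// mulr_suml.
apply: le_trans (dot_norm_sum _ _ _ _) _; apply: ler_sum => h /Elt hi.
by apply: IH; exact: leq_trans hi lein.
Qed.

Lemma pseudo_inverse_balance_lipschitz :
  dot_norm dotp (Sdag (balance z) - Sdag (balance z'))
  <= operator_norm dotN dotp Sdag
     * Num.sqrt (\sum_i (d i - 2 * dplus i) ^+ 2 / d i ^+ 2 * K_const E S i ^+ 2)
     * dot_norm dotp (x - x').
Proof.
have -> : Sdag (balance z) - Sdag (balance z') = Sdag (balance z - balance z').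
  by rewrite (pseudo_inverseE dot hS) tensor_idB.
apply: (@le_trans _ _ (operator_norm dotN dotp Sdag
    * dot_norm dotN (balance z - balance z'))).
  by rewrite (pseudo_inverseE dot hS); exact: operator_norm_tensor_id.
rewrite -mulrA; apply: ler_wpM2l.
  by rewrite (pseudo_inverseE dot hS); exact: operator_norm_ge0.
rewrite -[dot_norm dotp _]ger0_norm ?dot_norm_ge0// -sqrtr_sqr -sqrtrM; last first.
  by apply: sumr_ge0 => i _; rewrite mulr_ge0 ?divr_ge0 ?sqr_ge0.
rewrite ler_wsqrtr// mulr_suml; apply: ler_sum => i _.
rewrite -sqr_dot_norm -[(_ - _) i]/(_ *: z i - _ *: z' i) -scalerBr dot_normZ.
set c := _ - _; set k := dot_norm dotp _.
rewrite [leRHS](_ : _ = (`|c| * (K_const E S i / d i * k)) ^+ 2); last first.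
  by rewrite exprMn real_normK ?num_real//; field; rewrite gt_eqF.
have zk := shadow_lipschitz i.
have rhs0 : 0 <= K_const E S i / d i * k := le_trans (dot_norm_ge0 _ _) zk.
rewrite ler_sqr ?nnegrE ?(mulr_ge0 (normr_ge0 c)) ?dot_norm_ge0//.
exact: ler_wpM2l.
Qed.

End TwoPoints.
End Estimates.

(** * Demiclosedness *)

Section Limits.
Context {R : realType} {X : lmodType R} (dot : {dot X for idfun}).
Context {N p : nat} (E E' : rel 'I_N) (S : 'M[R]_(N, p)).
Hypotheses (Elt : forall i j, E i j -> (i < j)%N)
  (deg_gt0 : forall i, (0 < degree E i)%N)
  (E'E : forall i j, E' i j -> E i j) (E'conn : graph_connected E')
  (hS : onto_decomposition (laplacian E') S).

Local Notation dotp := (prod_dot dot (n:=p) : {dot ('I_p -> X) for idfun}).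
Local Notation dotN := (prod_dot dot (n:=N) : {dot ('I_N -> X) for idfun}).
Local Notation d i := ((degree E i)%:R : R).
Local Notation dplus i := ((in_degree E i)%:R : R).
Local Notation Sdag := (pseudo_inverse dotp dotN (tensor_id S)).

Let E'lt i j : E' i j -> (i < j)%N.
Proof. by move=> /E'E /Elt. Qed.

Lemma edge_le_adjoint (z : 'I_N -> X) h i : E' h i ->
  dot_norm dot (z h - z i) <= dot_norm dotp (tensor_id S^T z).
Proof.
move=> hi; rewrite -ler_sqr ?nnegrE ?dot_norm_ge0// !sqr_dot_norm.
rewrite (dot_adjoint_tensor_id dot E'lt hS) (bigD1 i) //= (bigD1 h) //= -addrA.
rewrite lerDl addr_ge0// ?sumr_ge0// => [j _|j _]; first exact: dot_ge0.
by apply: sumr_ge0 => k _; exact: dot_ge0.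
Qed.

(** The edges of the connected subgraph are controlled by [S^* z]. *)
Lemma consensus (F : set_system nat) {FF : Filter F} (z : nat -> 'I_N -> X) :
  dot_norm dotp (tensor_id S^T (z n)) @[n --> F] --> 0 ->
  forall i j, dot_norm dot (z n i - z n j) @[n --> F] --> 0.
Proof.
move=> Sz0; apply: graph_connected_ind (E'conn) _.
- by move=> i; under eq_fun do rewrite subrr dot_norm0; exact: cvg_cst.
- by move=> i j zij; under eq_fun do rewrite dot_normBC.
- move=> i j k zij zjk.
  apply: cvg0_le (_ : (dot_norm dot (z n i - z n j)
    + dot_norm dot (z n j - z n k)) @[n --> F] --> 0).
    by move=> n; rewrite dot_norm_ge0 dot_normB.
  by rewrite -[X in _ --> X](addr0 0); exact: cvgD.
- move=> h i hi; apply: cvg0_le Sz0 => n.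
  by rewrite dot_norm_ge0 edge_le_adjoint.
Qed.

Lemma consensus_weak_limit (F : set_system nat) {FF : Filter F}
    (z : nat -> 'I_N -> X) u i0 :
  dot_norm dotp (tensor_id S^T (z n)) @[n --> F] --> 0 ->
  weak_limit dot F (fun n => z n i0) u ->
  forall i, weak_limit dot F (fun n => z n i) u.
Proof.
move=> Sz0 zu i.
rewrite -[u]addr0; under eq_fun => n do rewrite -(subrKC (z n i0) (z n i)).
apply: weak_limitD => //; apply: weak_limit_strongly.
rewrite /strongly_converges; under eq_fun do rewrite subr0.
exact: consensus.
Qed.

Lemma weak_limit_coord {n : nat} (F : set_system nat) (u : nat -> 'I_n -> X) l j :
  weak_limit (prod_dot dot (n:=n)) F u l -> weak_limit dot F (fun k => u k j) (l j).
Proof.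
move=> ul v; have := ul (fun i => if i == j then v else 0).
have coord y : prod_dot dot y (fun i => if i == j then v else 0) = dot (y j) v.
  rewrite /prod_dot (bigD1 j) //= eqxx big1 ?addr0// => i ij.
  by rewrite (negbTE ij) dot0r.
by under eq_fun do rewrite /= coord; rewrite /= coord.
Qed.

(** The graphs of the [A i] pass to the weak limit because the pairing
    [\sum_i <z i, u i>] does: scaled by [gamma n] it equals
    [<S^* z, x> - \sum_(h -> i) |z h - z i|^2], which tends to zero. *)
Lemma dr_inclusion_demiclosed (G : set_system nat) {PG : ProperFilter G}
    (A : 'I_N -> X -> set X) (gamma : nat -> R) (gammabar M : R)
    (x : nat -> 'I_p -> X) (z : nat -> 'I_N -> X) l u i0 :
  (forall i, maximally_monotone dot (A i)) ->
  (forall n, 0 < gamma n) -> 0 < gammabar -> gamma @ G --> gammabar ->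
  (forall n, dr_inclusion E S A (gamma n) (x n) (z n)) ->
  (forall n, dot_norm dotp (x n) <= M) ->
  dot_norm dotp (tensor_id S^T (z n)) @[n --> G] --> 0 ->
  weak_limit dotp G x l -> weak_limit dot G (fun n => z n i0) u ->
  dr_inclusion E S A gammabar l (fun=> u).
Proof.
move=> maxA g0 gb0 ggb xz xM Sz0 xl zu0.
have zz : forall i j, dot_norm dot (z n i - z n j) @[n --> G] --> 0.
  exact: consensus Sz0.
have zu : forall i, weak_limit dot G (fun n => z n i) u.
  exact: consensus_weak_limit zu0.
have ginv : (gamma n)^-1 @[n --> G] --> gammabar^-1 by apply: cvgV => //; rewrite gt_eqF.
have resl i : weak_limit dot G (fun n => (gamma n)^-1 *: dr_residual E S (x n) (z n) i)
    (gammabar^-1 *: dr_residual E S l (fun=> u) i).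
  apply: weak_limitZ => //; rewrite /dr_residual.
  apply: weak_limitD; last first.
    rewrite -scaleNr; under eq_fun do rewrite -scaleNr.
    by apply: weak_limitZ => //; exact: cvg_cst.
  apply: weak_limitD.
    apply: weak_limitZ; first exact: cvg_cst.
    exact: weak_limit_sum.
  apply: weak_limit_sum => j _; apply: weak_limitZ; first exact: cvg_cst.
  exact: weak_limit_coord.
have pair0 : (\sum_i dot (z n i) ((gamma n)^-1 *: dr_residual E S (x n) (z n) i))
    @[n --> G] --> gammabar^-1 * (0 - 0).
  under eq_fun do rewrite (eq_bigr _ (fun i _ => dotZr dot _ _ _)) -mulr_sumr
    (dot_dr_residual dot S Elt).
  apply: cvgM => //; apply: cvgB.
    apply: cvg_dist_le (_ : dot_norm dotp (tensor_id S^T (z n)) * M @[n --> G] --> 0).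
      move=> n; rewrite subr0; apply: le_trans (CauchySchwarz_dot _ _ _) _.
      by rewrite ler_wpM2l// dot_norm_ge0.
    exact: cvg0M Sz0 (cvg_cst _).
  rewrite -[X in _ --> X](_ : \sum_(i < N) \sum_(h | E h i) 0 = 0); last first.
    by rewrite big1// => i _; rewrite big1.
  have sq0 h i : dot (z n h - z n i) (z n h - z n i) @[n --> G] --> (0 : R).
    under eq_fun do rewrite -sqr_dot_norm.
    exact: cvg0M (zz h i) (zz h i).
  by apply: cvg_sumr => i _; apply: cvg_sumr => h _; exact: sq0.
have pairl : \sum_i dot u (gammabar^-1 *: dr_residual E S l (fun=> u) i) = 0.
  rewrite (eq_bigr _ (fun i _ => dotZr dot _ _ _)) -mulr_sumr.
  rewrite (dot_dr_residual dot S Elt _ (fun=> u)).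
  rewrite (adjoint_tensor_id_const dot E'lt hS) dot0l sub0r big1 ?oppr0 ?mulr0//.
  by move=> i _; rewrite subrr dot0l big1.
apply: product_related => // y v yv.
pose r n i := (gamma n)^-1 *: dr_residual E S (x n) (z n) i.
pose rl i := gammabar^-1 *: dr_residual E S l (fun=> u) i.
have expand (a b : 'I_N -> X) : \sum_i dot (a i - y i) (b i - v i)
    = \sum_i dot (a i) (b i) - \sum_i dot (b i) (y i) - \sum_i dot (a i) (v i)
      + \sum_i dot (y i) (v i).
  rewrite -!sumrB -big_split /=; apply: eq_bigr => i _.
  by rewrite !dotE (dotC _ (y i) (b i)); ring.
have lim : (\sum_i dot (z n i - y i) (r n i - v i)) @[n --> G]
    --> \sum_i dot (u - y i) (rl i - v i).
  rewrite (expand (fun=> u)) pairl; move: pair0; rewrite subrr mulr0 => pair0.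
  under eq_fun do rewrite expand.
  apply: cvgD; last exact: cvg_cst.
  apply: cvgB; last by apply: cvg_sumr => i _; exact: zu.
  by apply: cvgB => //; apply: cvg_sumr => i _; exact: resl.
apply: ler_cvg_to (cvg_cst 0) lim _; apply: nearW => n.
by apply: sumr_ge0 => i _; apply: (proj1 (maxA i)) => //; exact: xz.
Qed.

(** * The trajectory *)

Section Trajectory.
Variables (A : 'I_N -> X -> set X) (theta gammabar : R) (gamma : nat -> R).
Variables (x w : nat -> 'I_p -> X) (z : nat -> 'I_N -> X).
Hypotheses (maxA : forall i, maximally_monotone dot (A i))
  (htheta : 0 < theta < 2) (gamma0 : forall n, 0 < gamma n) (gammabar0 : 0 < gammabar)
  (gamma_cvg : gamma @ \oo --> gammabar)
  (gamma_sum : (\sum_(0 <= n <oo)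
     (relocation_const dot E S (gamma n.+1) (gamma n) - 1)%:E < +oo)%E)
  (xz : forall n, dr_inclusion E S A (gamma n) (x n) (z n))
  (wE : forall n, w n = x n - theta *: tensor_id S^T (z n))
  (xE : forall n, x n.+1 = (gamma n.+1 / gamma n) *: w n
     + (1 - gamma n.+1 / gamma n) *: Sdag (balance E (z n))).

Section FixedPoint.
Variables (u : X) (a : 'I_N -> X).
Hypotheses (Aa : forall i, A i u (a i)) (suma : \sum_i a i = 0).

(** The fixed point associated with [u] and [a] for the parameter [g]. One step of
    the algorithm maps [q (gamma n)] to [q (gamma n.+1)]. *)
Let q (g : R) := Sdag (balance E (fun=> u)) + g *: Sdag a.

Let lip := operator_norm dotN dotp Sdag
  * Num.sqrt (\sum_i (d i - 2 * dplus i) ^+ 2 / d i ^+ 2 * K_const E S i ^+ 2).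

Let qP n : dr_inclusion E S A (gamma n) (q (gamma n)) (fun=> u).
Proof. exact: (dr_inclusion_const dot Elt E'E E'conn hS). Qed.

Let adjoint_diff n : tensor_id S^T (z n - (fun=> u)) = tensor_id S^T (z n).
Proof. by rewrite tensor_idB (adjoint_tensor_id_const dot E'lt hS) subr0. Qed.

Let mA i : monotone_operator dot (A i).
Proof. exact: (proj1 (maxA i)). Qed.

Let averaged n : dot_norm dotp (w n - q (gamma n)) ^+ 2
  <= dot_norm dotp (x n - q (gamma n)) ^+ 2
     - theta * (2 - theta) * dot_norm dotp (tensor_id S^T (z n)) ^+ 2.
Proof.
have [t0 t2] := andP htheta.
have := dr_averaged Elt E'E hS mA (gamma0 n) (xz n) (qP n) (ltW t0).
by rewrite adjoint_diff wE addrAC.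
Qed.

Let nonexpansive n :
  dot_norm dotp (w n - q (gamma n)) <= dot_norm dotp (x n - q (gamma n)).
Proof.
rewrite -ler_sqr ?nnegrE ?dot_norm_ge0//; apply: le_trans (averaged n) _.
have [t0 t2] := andP htheta.
by rewrite gerBl mulr_ge0 ?sqr_ge0// mulr_ge0 ?subr_ge0 ?ltW.
Qed.

Let step_le n : dot_norm dotp (x n.+1 - q (gamma n.+1))
  <= gamma n.+1 / gamma n * dot_norm dotp (w n - q (gamma n))
     + `|1 - gamma n.+1 / gamma n| * lip * dot_norm dotp (x n - q (gamma n)).
Proof.
set k := gamma n.+1 / gamma n.
have k0 : 0 <= k by rewrite divr_ge0 ?ltW.
have kE : k * gamma n = gamma n.+1 by rewrite divfK// gt_eqF.
have -> : x n.+1 - q (gamma n.+1) = k *: (w n - q (gamma n))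
    + (1 - k) *: (Sdag (balance E (z n)) - Sdag (balance E (fun=> u))).
  apply: (@dot_inj _ _ dotp) => v.
  by rewrite xE -/k /q -kE !dotE; ring.
apply: le_trans (dot_normD _ _ _) _; rewrite !dot_normZ (ger0_norm k0) lerD2l.
rewrite -mulrA ler_wpM2l//.
exact: (pseudo_inverse_balance_lipschitz Elt deg_gt0 hS mA (gamma0 n) (xz n) (qP n)).
Qed.

(** The iteration is Lipschitz with constant [relocation_const] and moves one fixed
    point to the next: the distances are quasi-Fejer monotone. *)
Lemma moving_distance_cvg : cvgn (fun n => dot_norm dotp (x n - q (gamma n))).
Proof.
apply: (quasi_Fejer_cvg _ _ _ gamma_sum) => [n|n|n].
- exact: dot_norm_ge0.
- by rewrite le_max lexx.
- apply: le_trans (step_le n) _.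
  set k := gamma n.+1 / gamma n.
  have k0 : 0 <= k by rewrite divr_ge0 ?ltW.
  apply: (@le_trans _ _ ((k + `|1 - k| * lip) * dot_norm dotp (x n - q (gamma n)))).
    by rewrite mulrDl lerD2r ler_wpM2l.
  apply: ler_wpM2r; first exact: dot_norm_ge0.
  by rewrite le_max; apply/orP; right; rewrite /lip mulrA.
Qed.

(** As [gamma n.+1 / gamma n] tends to 1, the relocation is asymptotically the
    identity, so [|w n - q|] and [|x n - q|] have the same limit; what the averaged
    operator gains between the two is a multiple of [|S^* z n|^2]. *)
Lemma adjoint_cvg0 : dot_norm dotp (tensor_id S^T (z n)) @[n --> \oo] --> 0.
Proof.
have /cvg_ex[/= r xr] := moving_distance_cvg.
have kcvg : (gamma n.+1 / gamma n) @[n --> \oo] --> (1 : R).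
  rewrite -(divff (lt0r_neq0 gammabar0)); apply: cvgM.
    by rewrite (cvg_shiftS gamma).
  by apply: cvgV => //; rewrite gt_eqF.
have xr1 : dot_norm dotp (x n.+1 - q (gamma n.+1)) @[n --> \oo] --> r.
  by rewrite -(cvg_shiftS (fun n => dot_norm dotp (x n - q (gamma n)))) in xr.
have wr : dot_norm dotp (w n - q (gamma n)) @[n --> \oo] --> r.
  apply: (squeeze_cvgr _ (_ : (dot_norm dotp (x n.+1 - q (gamma n.+1))
     - `|1 - gamma n.+1 / gamma n| * lip * dot_norm dotp (x n - q (gamma n)))
     / (gamma n.+1 / gamma n) @[n --> \oo] --> r) xr).
    apply: nearW => n; rewrite nonexpansive andbT.
    by rewrite ler_pdivrMr ?divr_gt0// lerBlDr mulrC.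
  rewrite (_ : r = (r - `|1 - 1| * lip * r) / 1); last first.
    by rewrite subrr normr0 !mul0r subr0 divr1.
  apply: cvgM; last by apply: cvgV => //; rewrite oner_eq0.
  have k1 : `|1 - gamma n.+1 / gamma n| @[n --> \oo] --> `|1 - 1 : R|.
    by apply: cvg_norm; apply: cvgB => //; exact: cvg_cst.
  exact: (cvgB xr1 (cvgM (cvgM k1 (cvg_cst lip)) xr)).
have [t0 t2] := andP htheta.
have tt0 : 0 < theta * (2 - theta) by rewrite mulr_gt0// subr_gt0.
have sq0 : dot_norm dotp (tensor_id S^T (z n)) ^+ 2 @[n --> \oo] --> 0.
  apply: cvg0_le (_ : ((dot_norm dotp (x n - q (gamma n)) ^+ 2
      - dot_norm dotp (w n - q (gamma n)) ^+ 2) / (theta * (2 - theta)))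
      @[n --> \oo] --> 0).
    move=> n; rewrite sqr_ge0 /= ler_pdivlMr// mulrC.
    by rewrite lerBrDr -lerBrDl averaged.
  rewrite -[X in _ --> X](mul0r (theta * (2 - theta))^-1) -(subrr (r ^+ 2)).
  by apply: cvgM; [apply: cvgB; apply: cvgM | exact: cvg_cst].
rewrite (_ : (fun n => _) = fun n =>
    Num.sqrt (dot_norm dotp (tensor_id S^T (z n)) ^+ 2)); last first.
  by apply/funext => n; rewrite sqrtr_sqr ger0_norm ?dot_norm_ge0.
have sqrt0 : Num.sqrt (dot_norm dotp (tensor_id S^T (z n)) ^+ 2) @[n --> \oo]
    --> Num.sqrt (0 : R).
  exact: (continuous_cvg _ (@sqrt_continuous R 0) sq0).
by move: sqrt0; rewrite sqrtr0.
Qed.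

Lemma distance_cvg : cvgn (fun n => dot_norm dotp (x n - q gammabar)).
Proof.
have /cvg_ex[/= r xr] := moving_distance_cvg.
apply/cvg_ex; exists r => /=; rewrite -[r]add0r.
rewrite (_ : (fun n => _) = fun n => (dot_norm dotp (x n - q gammabar)
    - dot_norm dotp (x n - q (gamma n))) + dot_norm dotp (x n - q (gamma n))).
  2: by apply/funext => n; rewrite subrK.
apply: cvgD => //.
apply: cvg_dist_le (_ : (`|gamma n - gammabar| * dot_norm dotp (Sdag a))
    @[n --> \oo] --> 0).
  move=> n; rewrite subr0; apply: le_trans (ler_dist_dot_norm _ _ _) _.
  rewrite -dot_normZ le_eqVlt; apply/orP; left; apply/eqP; congr dot_norm.
  by apply: (@dot_inj _ _ dotp) => v; rewrite /q !dotE; ring.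
rewrite -[X in _ --> X](mul0r (dot_norm dotp (Sdag a))) -(normr0 R) -(subrr gammabar).
apply: cvgM; last exact: cvg_cst.
by apply: cvg_norm; apply: cvgB => //; exact: cvg_cst.
Qed.

Lemma trajectory_bounded : exists M, forall n, dot_norm dotp (x n) <= M.
Proof.
have [M hM] := cvgn_bounded distance_cvg.
exists (M + dot_norm dotp (q gammabar)) => n.
rewrite -{1}[x n](subrK (q gammabar)); apply: le_trans (dot_normD _ _ _) _.
by rewrite lerD2r; exact: le_trans (ler_norm _) (hM n).
Qed.

Lemma shadow_bounded i : exists M, forall n, dot_norm dot (z n i) <= M.
Proof.
have [M hM] := cvgn_bounded moving_distance_cvg.
exists (`|K_const E S i / d i| * M + dot_norm dot u) => n.
rewrite -[z n i](subrK u); apply: le_trans (dot_normD _ _ _) _; rewrite lerD2r.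
apply: le_trans (shadow_lipschitz Elt deg_gt0 mA (gamma0 n) (xz n) (qP n) i) _.
apply: le_trans (ler_norm _) _; rewrite normrM ler_wpM2l//; exact: hM.
Qed.

End FixedPoint.
End Trajectory.
End Limits.

(** * Convergence *)

Theorem corollary5p4 (R : realType) (X : completeNormedModType R)
    (dot : {dot X for idfun}) (hdot : forall u : X, `|u| ^+ 2 = dot u u)
    (N : nat) (hN : (2 <= N)%N)
    (E E' : rel 'I_N)
    (hE : forall i j : 'I_N, E i j -> (i < j)%N)
    (hEconn : graph_connected E)
    (hE' : forall i j : 'I_N, E' i j -> E i j)
    (hE'conn : graph_connected E')
    (S : 'M[R]_(N, N.-1)) (hS : onto_decomposition (laplacian E') S)
    (A : 'I_N -> X -> set X)
    (hA : forall i : 'I_N, maximally_monotone dot (A i))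
    (hzer : zer (sum_operator A) !=set0)
    (Gamma : set R) (hGamma0 : Gamma !=set0)
    (hGamma : forall gamma : R, Gamma gamma -> 0 < gamma)
    (theta : R) (htheta : 0 < theta < 2)
    (gamma : nat -> R) (hgamma : forall n : nat, Gamma (gamma n))
    (gammabar : R) (hgammabar : Gamma gammabar)
    (hgamma_cvg : gamma @ \oo --> gammabar)
    (hgamma_sum : (\sum_(0 <= n <oo)
       (relocation_const dot E S (gamma n.+1) (gamma n) - 1)%:E < +oo)%E)
    (x w : nat -> 'I_N.-1 -> X) (z e : nat -> 'I_N -> X) :
  let d : 'I_N -> R := fun i => (degree E i)%:R in
  let dplus : 'I_N -> R := fun i => (in_degree E i)%:R in
  let i1 : 'I_N := Ordinal (ltnW hN) in
  let dotN1 : {dot ('I_N.-1 -> X) for idfun} := prod_dot dot (n:=N.-1) in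
  let dotN : {dot ('I_N -> X) for idfun} := prod_dot dot (n:=N) in
  let SS : ('I_N.-1 -> X) -> 'I_N -> X := tensor_id S in
  (forall (n : nat) (i : 'I_N),
    z n i = resolvent (scale_operator (gamma n / d i) (A i))
      ((2 / d i) *: (\sum_(h | E h i) z n h)
       + (d i)^-1 *: (\sum_j S i j *: x n j))) ->
  (forall n : nat, w n = x n - theta *: adjoint dotN1 dotN SS (z n)) ->
  (forall (n : nat) (i : 'I_N),
    e n i = (if i == i1 then d i1 *: z n i1 else (d i - 2 * dplus i) *: z n i)
      - N%:R^-1 *: (d i1 *: z n i1
                    + \sum_(k | k != i1) (d k - 2 * dplus k) *: z n k)) ->
  (forall n : nat,
    x n.+1 = (gamma n.+1 / gamma n) *: w n
      + (1 - gamma n.+1 / gamma n) *: pseudo_inverse dotN1 dotN SS (e n)) ->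
  exists xbar : 'I_N.-1 -> X,
    [/\ dr_operator dot E S A theta gammabar xbar = xbar,
        weakly_converges dotN1 x xbar,
        weakly_converges dotN1 w xbar
      & let zbar : X := resolvent (scale_operator (gammabar / d i1) (A i1))
                          ((d i1)^-1 *: (\sum_j S i1 j *: xbar j)) in
        zer (sum_operator A) zbar
        /\ forall i : 'I_N, weakly_converges dot (fun n => z n i) zbar].
Proof.
move=> d dplus i1 dotN1 dotN SS hz hw he hx.
have cX := complete_dot_normed hdot.
have deg_gt0 i : (0 < degree E i)%N by exact: degree_gt0.
have gamma0 n : 0 < gamma n by exact: hGamma.
have gammabar0 : 0 < gammabar by exact: hGamma.
have mA i : monotone_operator dot (A i) by exact: (proj1 (hA i)).
have E'lt i j : E' i j -> (i < j)%N by move=> /hE' /hE.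
have inclusionP g y v : 0 < g ->
    (forall i, v i = dr_step E S A g y v i) <-> dr_inclusion E S A g y v.
  by move=> g0; exact: (dr_inclusionP S deg_gt0 y v cX hA g0).
have xz n : dr_inclusion E S A (gamma n) (x n) (z n).
  by apply/inclusionP => // i; exact: hz.
have wE n : w n = x n - theta *: tensor_id S^T (z n).
  by rewrite hw (adjoint_tensor_id dot S).
have dplus1 : dplus i1 = 0.
  rewrite /dplus /in_degree eq_card0// => j; rewrite inE.
  by apply/negP; rewrite inE => /hE.
have eE n : pseudo_inverse dotN1 dotN SS (e n)
    = pseudo_inverse dotN1 dotN SS (balance E (z n)).
  set c := N%:R^-1 *: (d i1 *: z n i1
    + \sum_(k | k != i1) (d k - 2 * dplus k) *: z n k).
  have -> : e n = balance E (z n) - (fun=> c).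
    apply/funext => i; rewrite he /balance; congr (_ - _).
    by have [->|//] := eqVneq i i1; rewrite -[(in_degree E i1)%:R]/(dplus i1) dplus1
      mulr0 subr0.
  rewrite /SS (pseudo_inverseE dot hS) tensor_idB -(pseudo_inverseE dot hS).
  by rewrite (pseudo_inverse_const dot E'lt hS) subr0.
have xE n : x n.+1 = (gamma n.+1 / gamma n) *: w n
    + (1 - gamma n.+1 / gamma n) *: pseudo_inverse dotN1 dotN SS (balance E (z n)).
  by rewrite hx eE.
have [u0 [a0 [Aa0 /esym suma0]]] := hzer.
have Sz0 := adjoint_cvg0 hE deg_gt0 hE' hE'conn hS hA htheta gamma0 gammabar0
  hgamma_cvg hgamma_sum xz wE xE Aa0 suma0.
have [M xM] := trajectory_bounded hE deg_gt0 hE' hE'conn hS hA htheta gamma0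
  hgamma_cvg hgamma_sum xz wE xE Aa0 suma0.
have zM i := shadow_bounded hE deg_gt0 hE' hE'conn hS hA htheta gamma0
  hgamma_sum xz wE xE Aa0 suma0 i.
have cXN : complete_dot dotN1 by exact: complete_prod_dot.
(* weak limits along an ultrafilter solve the inclusions for the limit parameter *)
have closed_limit (G : set_system nat) l u : UltraFilter G -> \oo `<=` G ->
    weak_limit dotN1 G x l -> weak_limit dot G (fun n => z n i1) u ->
    dr_inclusion E S A gammabar l (fun=> u).
  move=> UG ooG xl zu; have PG := @ultra_proper _ _ UG.
  apply: (dr_inclusion_demiclosed hE hE' hE'conn hS hA gamma0 gammabar0 _ xz xM _ xl zu).
    exact: cvg_subfilter hgamma_cvg.
  exact: cvg_subfilter Sz0.
have [l [[u lu] xl]] : exists l, (exists u, dr_inclusion E S A gammabar l (fun=> u))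
    /\ weakly_converges dotN1 x l.
  apply: (Opial cXN xM) => [l [u lu]|G UG ooG l xl].
    have [a [Aa suma ->]] := dr_inclusion_const_inv dot hE hE' hS gammabar0 lu.
    exact: (distance_cvg hE deg_gt0 hE' hE'conn hS hA htheta gamma0
      hgamma_cvg hgamma_sum xz wE xE Aa suma).
  have [B zB] := zM i1.
  have [u zu] := bounded_weak_limit cX (G := G) zB.
  by exists u; exact: closed_limit xl zu.
have shadowE := dr_shadow_unique hE (proj2 (inclusionP _ _ _ gammabar0) lu).
have z1E : resolvent (scale_operator (gammabar / d i1) (A i1))
    ((d i1)^-1 *: (\sum_j S i1 j *: l j)) = u.
  rewrite [RHS](proj2 (inclusionP _ _ _ gammabar0) lu i1) /dr_step.
  rewrite [\sum_(h | E h i1) _]big_pred0 ?scaler0 ?add0r// => h.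
  by apply/negP => /hE.
exists l; split.
- rewrite /dr_operator shadowE (adjoint_tensor_id dot S).
  by rewrite (adjoint_tensor_id_const dot E'lt hS) scaler0 subr0.
- exact: xl.
- have -> : w = fun n => x n + - theta *: tensor_id S^T (z n).
    by apply/funext => n; rewrite wE scaleNr.
  rewrite -[l]addr0 -[X in l + X](scaler0 _ (- theta)).
  apply: weak_limitD; first exact: xl.
  apply: weak_limitZ; first exact: cvg_cst.
  apply: weak_limit_strongly; rewrite /strongly_converges.
  by under eq_fun do rewrite subr0.
move=> zbar; rewrite {}/zbar z1E; split.
  have [a [Aa suma _]] := dr_inclusion_const_inv dot hE hE' hS gammabar0 lu.
  by exists a; rewrite suma.
(* along any ultrafilter [z _ i] has a weak limit [k], the common value of a shadow
   of [l]; shadows are unique, so [k = u] *)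
move=> i v; apply: cvg_ultra => G UG ooG; have PG := @ultra_proper _ _ UG.
have [B zB] := zM i1.
have [k zk] := bounded_weak_limit cX (G := G) zB.
have lk : dr_inclusion E S A gammabar l (fun=> k).
  by apply: closed_limit zk => // y; exact: cvg_subfilter (xl y).
have uk : u = k.
  apply/eqP; rewrite -subr_eq0; apply/eqP/(@dot_norm_eq0 _ _ dot)/eqP.
  rewrite eq_le dot_norm_ge0 andbT.
  have := shadow_lipschitz hE deg_gt0 mA gammabar0 lu lk i.
  by rewrite subrr dot_norm0 mulr0.
rewrite uk.
exact: (consensus_weak_limit hE hE' hE'conn hS (cvg_subfilter ooG Sz0) zk).
Qed.
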